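(* Assume the extinction time $T_0^-$ is a.s. finite (i.e. $\mathsf P_y(T_0^-<\infty)=1$ for all $y\in\mathbb N_0$) and $\phi<1$. Let $\{x,a\}\subset\mathbb N_0$, $a<x$. Then $$\mathsf P_x[T_a^-]=\int_0^1(v^a-v^x)\,\frac{\exp\left\{\int_v^1\frac{\mu(1-\tilde r(w))}{\lambda(\tilde p(w)-w)}\,\mathrm dw\right\}}{\lambda(\tilde p(v)-v)}\,\mathrm dv.$$
   Context: Setting. $\mathbb N=\{1,2,\dots\}$, $\mathbb N_0=\mathbb N\cup\{0\}$. Fix $\lambda\in(0,\infty)$, $\mu\in[0,\infty)$, a probability distribution $p=(p_k)_{k\in\mathbb N_0}$ with $p_0>0$ and $p_1=0$, and a probability distribution $r=(r_k)_{k\in\{-1\}\cup\mathbb N}$ (put $r_0:=0$). Assume that $\mu r_k>0$ for some $k\in\mathbb N$ or $p_0<1$. Under probabilities $(\mathsf P_x)_{x\in\mathbb N_0}$, $X=(X_t)_{t\in[0,\infty)}$ is a minimal càdlàg continuous-time Markov chain with state space $\mathbb N_0$, started from $x$ under $\mathsf P_x$, with explosion time (lifetime) $\zeta$, $X$ being set equal to $\infty$ on $[\zeta,\infty)$, and with conservative generator matrix $(Q_{ij})$: $Q_{00}=0$ (state $0$ is absorbing) and, for $n\in\mathbb N$, $-Q_{nn}=\lambda n+\mu$, $Q_{n(n+m)}=p_{m+1}\lambda n+r_m\mu$ for $m\in\mathbb N\cup\{-1\}$. For $a\in\mathbb N_0$, $T_a^-:=\inf\{t\in[0,\zeta):X_t\le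 a\}$, $\inf\emptyset:=\infty$. $\mathsf P_x[F]$ denotes the expectation of $F$ under $\mathsf P_x$ (values in $[0,\infty]$ allowed for nonnegative $F$). Generating functions and roots. For $z\in(0,1]$, $\tilde p(z):=\sum_{k=0}^\infty p_kz^k$ and $\tilde r(z):=\sum_{k=-1}^\infty r_kz^k$. If $\mu r_{-1}>0$, $\phi$ is the smallest root of $\tilde r(z)=1$ in $z\in(0,1]$; if $\mu r_{-1}=0$, then $\phi:=0$. *)

(* Defs.v *)
From HB Require Import structures.
From mathcomp Require Import all_boot all_order all_algebra.
From mathcomp Require Import all_classical all_reals all_analysis.
Set Implicit Arguments.
Unset Strict Implicit.
Unset Printing Implicit Defensive.
Import Order.TTheory GRing.Theory Num.Theory.
Import numFieldNormedType.Exports.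
Local Open Scope classical_set_scope.
Local Open Scope ring_scope.

(* Paths are functions [f : R -> option nat], used at times t >= 0 only; the
   value [None] stands for the cemetery state infinity. *)
Section Paths.
Variable R : realType.
Implicit Type f : R -> option nat.

(* [jump_data f n] is the pair of the n-th jump time J_n and of the state Y_n
   entered at that time: J_0 = 0, J_(n+1) = inf {t >= J_n | f t <> Y_n}.  When
   J_(n+1) = +oo (no further jump) the jump chain stays put: Y_(n+1) = Y_n. *)
Fixpoint jump_data f (n : nat) : \bar R * option nat :=
  if n is m.+1 then
    let: (s, y) := jump_data f m in
    let s' := ereal_inf [set t%:E | t in [set t : R | (s <= t%:E)%E /\ f t <> y]]
    in (s', if s' is EFin t then f t else y)
  else (0%E, f 0).

Definition jump_time f (n : nat) : \bar R := (jump_data f n).1.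

Definition jump_chain f (n : nat) : option nat := (jump_data f n).2.

(* The time spent in Y_n; +oo when J_n is already infinite, where the extended
   difference J_(n+1) - J_n would be -oo. *)
Definition holding_time f (n : nat) : \bar R :=
  if jump_time f n is EFin s then (jump_time f n.+1 - s%:E)%E else +oo%E.

Definition explosion_time f : \bar R := ereal_sup (range (jump_time f)).

(* On [0, zeta) the path is cadlag in the discrete space of naturals, which is
   why limits are expressed by eventual equality. *)
Definition minimal_cadlag f : Prop :=
  [/\ forall t : R, 0 <= t -> (t%:E < explosion_time f)%E ->
        f t <> None /\ \forall s \near t^'+, f s = f t,
      forall t : R, 0 < t -> (t%:E < explosion_time f)%E ->
        exists i : nat, \forall s \near t^'-, f s = Some i
    & forall t : R, 0 <= t -> (explosion_time f <= t%:E)%E -> f t = None].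

Definition first_passage_below (a : nat) f : \bar R :=
  ereal_inf [set t%:E | t in [set t : R |
    [/\ 0 <= t, (t%:E < explosion_time f)%E &
        exists2 k : nat, f t = Some k & (k <= a)%N]]].

End Paths.

Section MarkovChain.
Variables (R : realType) (Q : nat -> nat -> R).

Definition exit_rate (i : nat) : R := - Q i i.

Definition jump_matrix (i j : nat) : R :=
  if exit_rate i == 0 then (i == j)%:R
  else if i == j then 0 else Q i j / exit_rate i.

(* The minimal chain with generator matrix Q: under [P x] the jump chain is a
   discrete-time Markov chain started from x with transition matrix
   [jump_matrix], and, conditionally on Y_0, ..., Y_n, the holding times
   S_0, ..., S_n are independent, S_k being exponential of rate
   [exit_rate Y_k] (identically +oo if that rate vanishes). *)
Definition minimal_markov_chain (d : measure_display) (T : measurableType d)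
    (P : nat -> probability T R) (X : R -> T -> option nat) : Prop :=
  [/\ forall (t : R) (i : option nat), 0 <= t ->
        measurable [set w | X t w = i],
      forall w : T, minimal_cadlag (X ^~ w),
      forall (x n : nat) (y : nat -> nat),
        P x [set w | forall k, (k <= n)%N ->
                       jump_chain (X ^~ w) k = Some (y k)] =
        ((y 0%N == x)%:R * \prod_(k < n) jump_matrix (y k) (y k.+1))%:E
    & forall (x n : nat) (y : nat -> nat) (u : nat -> R),
        (forall k, 0 <= u k) ->
        P x [set w | forall k, (k <= n)%N ->
                       jump_chain (X ^~ w) k = Some (y k) /\
                       ((u k)%:E < holding_time (X ^~ w) k)%E] =
        (P x [set w | forall k, (k <= n)%N ->
                        jump_chain (X ^~ w) k = Some (y k)] *
         (\prod_(k < n.+1) expR (- (exit_rate (y k) * u k)))%:E)%E].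

End MarkovChain.

Section Model.
Variable R : realType.

Definition is_distribution (q : nat -> R) : Prop :=
  (forall k, 0 <= q k) /\ series q @ \oo --> (1 : R).

(* The law r on {-1} u {1, 2, ...} is a function on all of [int] vanishing off
   that set, so that [fun k => r (k%:Z - 1)] lists r_(-1), r_0 = 0, r_1, ... *)
Record admissible (lam mu : R) (p : nat -> R) (r : int -> R) : Prop :=
  Admissible {
    lam_gt0 : 0 < lam;
    mu_ge0 : 0 <= mu;
    p_distribution : is_distribution p;
    p0_gt0 : 0 < p 0%N;
    p1_eq0 : p 1%N = 0;
    r_distribution : is_distribution (fun k : nat => r (k%:Z - 1));
    r0_eq0 : r 0 = 0;
    r_support : forall k : int, k < -1 -> r k = 0;
    up_jumps : (exists k : nat, (0 < k)%N /\ 0 < mu * r k%:Z) \/ p 0%N < 1 }.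

Definition generator (lam mu : R) (p : nat -> R) (r : int -> R)
    (n j : nat) : R :=
  if n == 0%N then 0
  else if j == n then - (lam * n%:R + mu)
  else if (n <= j.+1)%N then
    p (j.+1 - n)%N * lam * n%:R + r (j%:Z - n%:Z) * mu
  else 0.

Definition pgf_p (p : nat -> R) (z : R) : R :=
  limn (series (fun k : nat => p k * z ^+ k)).

Definition pgf_r (r : int -> R) (z : R) : R :=
  limn (series (fun k : nat => r (k%:Z - 1) * z ^ (k%:Z - 1))).

Definition is_phi (mu : R) (r : int -> R) (phi : R) : Prop :=
  if 0 < mu * r (-1) then
    [/\ 0 < phi <= 1, pgf_r r phi = 1
      & forall z : R, 0 < z <= 1 -> pgf_r r z = 1 -> phi <= z]
  else phi = 0.

End Model.

(* Main.v *)
Require Import Defs.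
From HB Require Import structures.
From mathcomp Require Import all_boot all_order all_algebra.
From mathcomp Require Import all_classical all_reals all_analysis.
From mathcomp Require Import measurable_realfun zify ring lra.
Set Implicit Arguments.
Unset Strict Implicit.
Unset Printing Implicit Defensive.
Import Order.TTheory GRing.Theory Num.Theory.
Import numFieldNormedType.Exports.
Local Open Scope classical_set_scope.
Local Open Scope ring_scope.

(** The mean first passage time is computed by a discrete Dynkin formula for an
    explicit family of functions of the state.

    Write A(v) = lam (p~(v) - v), B(v) = mu (1 - r~(v)) and q(i) = lam i + mu.
    The generator maps the function n |-> v^n to n v^(n-1) A(v) - v^n B(v).  If
    beta is an antiderivative of B/A on the open unit interval, then
    W = exp(-beta)/A makes (n v^(n-1) A - v^n B) W the derivative of
    v^n exp(-beta(v)).  Hence for 0 < e < s < 1 the function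

      F(j) = the integral over [e, s] of (v^a - v^j) W(v)

    is bounded, vanishes at a, and in one jump from i > a it loses on average
    (s^i exp(-beta(s)) - e^i exp(-beta(e))) / q(i)   ([potential_kernel]);
    nothing is lost by killing the chain on entering the states up to a, since
    downward jumps have size one.

    On the probabilistic side, the first passage time is the sum of the holding
    times before it, and the holding time in i has mean 1/q(i).  So its mean is
    the sum, over the steps n and the states i, of u_n(i) / q(i), where u_n is the
    law of the jump chain killed at the first passage ([mean_first_passage]).
    Comparing F along the killed chain ([superharmonic_le], [subharmonic_le]),
    and using that almost sure extinction removes the surviving mass, bounds
    exp(beta(s)) F(x) above by this sum ([potential_le_green]), and below, for
    small e, by the same sum with the extra factor s^(i+1)
    ([green_le_potential]).  Letting e tend to 0 and s to 1, all limits are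
    monotone, so that they also cover the case of infinite values: B >= 0 on
    [phi, 1] by convexity of the generating function of r ([drift_r_ge0]), so
    exp(beta(s) - beta(v)) increases to the exponential in the formula
    ([exponent_cvg]).

    It remains to know that A > 0 on the open unit interval.  Otherwise some
    m < 1 has A(m) < 0, the function n |-> m^n is superharmonic at large n, and
    the chain survives with positive probability ([drift_p_gt0]).

    Measurability of the jump skeleton is not part of the definition of the
    chain; it follows from right-continuity ([measurable_jump]). *)

(** * Jump skeleton of a right-continuous path *)

Section Paths.
Variable R : realType.
Implicit Type f : R -> option nat.

(** Right-continuity also holds from the explosion time on, where the path is
    frozen in the cemetery state. *)
Lemma cadlag_right f t : minimal_cadlag f -> 0 <= t ->
  \forall s \near t^'+, f s = f t.
Proof.
move=> [f1 _ f3] t0; have [tz|zt] := ltP t%:E (explosion_time f).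
  by have [] := f1 _ t0 tz.
near=> s.
have ts : t <= s by apply: ltW.
by rewrite !f3// ?(le_trans t0)// (le_trans zt)// lee_fin.
Unshelve. all: by end_near. Qed.

Lemma cadlag_right_itv f t : minimal_cadlag f -> 0 <= t ->
  exists2 d : R, t < d & forall s, t < s < d -> f s = f t.
Proof.
move=> cf t0; have := cadlag_right cf t0.
move=> /nbhs_ballP[d /= d0 H]; exists (t + d); first by rewrite ltrDl.
move=> s /andP[ts st]; apply: H => //.
by rewrite /ball/= distrC gtr0_norm ?subr_gt0// ltrBlDl.
Qed.

Lemma jump_time0 f : jump_time f 0 = 0%E. Proof. by []. Qed.

Lemma jump_timeS f n : jump_time f n.+1 =
  ereal_inf [set t%:E | t in [set t : R | (jump_time f n <= t%:E)%E /\
                                          f t <> jump_chain f n]].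
Proof. by rewrite /jump_time /jump_chain /=; case: (jump_data f n). Qed.

Lemma jump_chainS f n : jump_chain f n.+1 =
  if jump_time f n.+1 is EFin t then f t else jump_chain f n.
Proof. by rewrite /jump_time /jump_chain /=; case: (jump_data f n). Qed.

Lemma le_jump_timeS f n : (jump_time f n <= jump_time f n.+1)%E.
Proof. by rewrite jump_timeS; apply: le_ereal_inf_tmp => _ [t [+ _] <-]. Qed.

Lemma jump_time_nd f : nondecreasing_seq (jump_time f).
Proof. by apply/nondecreasing_seqP => n; exact: le_jump_timeS. Qed.

Lemma jump_time_ge0 f n : (0 <= jump_time f n)%E.
Proof. by rewrite -(jump_time0 f); exact: jump_time_nd. Qed.

Lemma jump_chain_at f n s : jump_time f n = s%:E -> jump_chain f n = f s.
Proof.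
case: n => [[<-]//|n js]; by rewrite jump_chainS js.
Qed.

Lemma path_between_jumps f n t :
  (jump_time f n <= t%:E < jump_time f n.+1)%E -> f t = jump_chain f n.
Proof.
move=> /andP[jt]; rewrite jump_timeS => tj.
apply: contrapT => ft; move: tj; apply/negP; rewrite -leNgt.
by apply: ereal_inf_lbound; exists t.
Qed.

Lemma jump_index f t : 0 <= t -> (t%:E < explosion_time f)%E ->
  exists n, (jump_time f n <= t%:E < jump_time f n.+1)%E.
Proof.
move=> t0 /ereal_sup_gt[_ [n _ <-]].
elim: n => [|n ih]; first by rewrite jump_time0 lte_fin ltNge t0.
move=> tn; have [ntt|/ih//] := leP (jump_time f n) t%:E.
by exists n; rewrite ntt.
Qed.

End Paths.

Section Measurability.
Context d (T : measurableType d) (R : realType).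

(** The entrance time of a set that is open to the right in time is attained
    in the limit along rational times, so countably many events decide
    whether it lies before [r]. *)
Lemma measurable_debut (B : R -> set T) :
  (forall w t, B t w -> exists2 e : R, t < e & forall s, t < s < e -> B s w) ->
  (forall t, measurable (B t)) ->
  measurable_fun setT
    (fun w => ereal_inf [set t%:E | t in [set t : R | B t w]]).
Proof.
move=> oB mB.
apply: (measurability _ (ErealGenInftyO.measurableE R)) => _ /= -[_ [r ->] <-].
rewrite setTI [X in measurable X](_ : _ =
  \bigcup_(q : rat) if ratr q < r then B (ratr q) else set0); last first.
  apply/seteqP; split => w /=; rewrite in_itv/=.
    move=> /ereal_inf_lt[_ [t Bt <-]]; rewrite lte_fin => tr.
    have [e te Be] := oB _ _ Bt.
    have [q /[!in_itv]/= /andP[tq qe]] : exists q : rat, ratr q \in `]t, (Order.min e r)[.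
      by apply: rat_in_itvoo; rewrite lt_min te tr.
    move: qe; rewrite lt_min => /andP[qe qr].
    by exists q => //; rewrite qr; apply: Be; rewrite tq qe.
  move=> [q _]; case: ifPn => // qr Bq.
  apply: (@le_lt_trans _ _ (ratr q)%:E); last by rewrite lte_fin.
  by apply: ereal_inf_lbound; exists (ratr q).
by apply: bigcupT_measurable_rat => q; case: ifPn.
Qed.

Variable X : R -> T -> option nat.
Hypothesis mX : forall (t : R) (i : option nat), 0 <= t ->
  measurable [set w | X t w = i].
Hypothesis cX : forall w : T, minimal_cadlag (X ^~ w).

Lemma measurable_option_eq (A B : T -> option nat) :
  (forall i, measurable [set w | A w = i]) ->
  (forall i, measurable [set w | B w = i]) ->
  measurable [set w | A w = B w].
Proof.
move=> mA mB; rewrite [X in measurable X](_ : _ =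
  ([set w | A w = None] `&` [set w | B w = None]) `|`
  \bigcup_(i : nat) ([set w | A w = Some i] `&` [set w | B w = Some i])).
  apply: measurableU; first exact: measurableI.
  by apply: bigcupT_measurable => i; exact: measurableI.
apply/seteqP; split=> w /=.
  move=> AB; case Bw: (B w) => [i|]; last by left; rewrite AB.
  by right; exists i => //; split=> //=; rewrite AB.
by move=> [[-> ->]|[i _ [-> ->]]].
Qed.

(** Jump times are entrance times as above.  The state entered at a finite
    jump time is read off, by right-continuity, from the values at the rational
    times just after it. *)
Lemma measurable_jump n :
  measurable_fun setT (fun w => jump_time (X ^~ w) n) /\
  forall i, measurable [set w | jump_chain (X ^~ w) n = i].
Proof.
elim: n => [|n [mJ mY]].
  by split=> [|i]; [exact: measurable_cst|exact: mX].
have mJS : measurable_fun setT (fun w => jump_time (X ^~ w) n.+1).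
  under eq_fun do rewrite jump_timeS.
  apply: measurable_debut => [w t [/= jt Xt]|t].
    have t0 : 0 <= t by rewrite -lee_fin (le_trans (jump_time_ge0 _ _) jt).
    have [e te He] := cadlag_right_itv (cX w) t0.
    exists e => // s /andP[ts se]; split; last by rewrite He// ts.
    by rewrite (le_trans jt)// lee_fin ltW.
  have [t0|t0] := leP 0 t; last first.
    rewrite [X in measurable X](_ : _ = set0)//; apply/seteqP; split=> w //=.
    by move=> [/(le_trans (jump_time_ge0 _ _))]; rewrite lee_fin leNgt t0.
  apply: measurableI.
    by rewrite -[X in measurable X]setTI; exact: emeasurable_fun_infty_c.
  apply: measurableC; apply: measurable_option_eq => // i.
  exact: mX.
split=> // i.
pose Z w := jump_time (X ^~ w) n.+1.
have mZ : measurable_fun setT Z by exact: mJS.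
(* for some m, every rational q in ]Z, Z + 1/(m+1)[ satisfies X q = i; the test
   on the sign of q is there because X is only controlled at times >= 0 *)
rewrite [X in measurable X](_ : _ =
  ([set w | Z w = +oo%E] `&` [set w | jump_chain (X ^~ w) n = i]) `|`
  ([set w | (Z w < +oo)%E] `&` \bigcup_(m : nat) ~` \bigcup_(q : rat)
    (if 0 <= ratr q :> R then
    ([set w | (Z w < (ratr q)%:E)%E] `&` [set w | ((ratr q - m.+1%:R^-1)%:E < Z w)%E]
     `&` ~` [set w | X (ratr q) w = i]) else set0))).
  apply: measurableU; apply: measurableI => //.
  - rewrite -[X in measurable X]setTI; exact: (mZ measurableT [set +oo%E]).
  - by rewrite -[X in measurable X]setTI; exact: (emeasurable_fun_infty_o measurableT mZ).
  - apply: bigcupT_measurable => m; apply: measurableC.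
    apply: bigcupT_measurable_rat => q; case: ifPn => // q0.
    apply: measurableI; first apply: measurableI.
    + by rewrite -[X in measurable X]setTI; exact: (emeasurable_fun_infty_o measurableT mZ).
    + by rewrite -[X in measurable X]setTI; exact: (emeasurable_fun_o_infty measurableT mZ).
    + by apply: measurableC; exact: mX.
apply/seteqP; split => w /=; rewrite jump_chainS -/(Z w).
  have := jump_time_ge0 (X ^~ w) n.+1; rewrite -/(Z w).
  case Zw: (Z w) => [s|//|//]; last by left.
  rewrite lee_fin => s0 Xs; right; split; first exact: ltry.
  have [e se He] := cadlag_right_itv (cX w) s0.
  have [m me] : exists m : nat, m.+1%:R^-1 < e - s.
    have es : 0 < e - s by rewrite subr_gt0.
    have [m _ /(_ m (leqnn m)) /= me] := near_infty_natSinv_lt (PosNum es).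
    by exists m.
  exists m => // -[q _]; case: ifPn => // q0 [[/=]]; rewrite Zw !lte_fin => sq.
  move: me; move: (m.+1%:R^-1) => h me qs; apply; rewrite -Xs; apply: He.
  by rewrite sq/=; lra.
move=> [[Zy Yi]|[Zy [m _ Hm]]]; first by rewrite Zy.
have := jump_time_ge0 (X ^~ w) n.+1; move: Zy Hm; rewrite -/(Z w).
case Zw: (Z w) => [s|//|//] _ Hm; rewrite lee_fin => s0.
have [e se He] := cadlag_right_itv (cX w) s0.
have [q] : exists q : rat, ratr q \in `]s, (Order.min e (s + m.+1%:R^-1))[.
  by apply: rat_in_itvoo; rewrite lt_min se ltrDl invr_gt0 ltr0n.
rewrite in_itv/= lt_min => /andP[sq /andP[qe qm]].
rewrite -(He (ratr q)) ?sq//; apply: contrapT => Xq; apply: Hm.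
exists q => //; rewrite (le_trans s0 (ltW sq)).
by split=> //; split => /=; rewrite Zw lte_fin// ltrBlDr.
Qed.
End Measurability.

(** * First passage as a sum of holding times *)

Section Passage.
Variable R : realType.
Implicit Type f : R -> option nat.

(** A cemetery state counts as not above [a], so that staying above includes
    not having exploded. *)
Definition above (a : nat) (o : option nat) : bool :=
  if o is Some k then (a < k)%N else false.

Definition stays_above a f n := all (above a \o jump_chain f) (iota 0 n.+1).

Lemma stays_aboveP a f n :
  reflect (forall k : nat, (k <= n)%N -> above a (jump_chain f k))
    (stays_above a f n).
Proof.
rewrite /stays_above; apply: (iffP allP) => H k.
  by move=> kn; apply: H; rewrite mem_iota.
by rewrite mem_iota => /andP[_ kn]; apply: H.
Qed.

Lemma holding_time_ge0 f n : (0 <= holding_time f n)%E.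
Proof.
rewrite /holding_time; case jn: (jump_time f n) => [s| |]//.
by rewrite sube_ge0// -jn le_jump_timeS.
Qed.

Lemma sum_holding_time f n s : jump_time f n = s%:E ->
  (\sum_(0 <= k < n) holding_time f k = s%:E)%E.
Proof.
elim: n s => [s [<-]|n ih s js]; first by rewrite big_nil.
have [u ju] : exists u, jump_time f n = u%:E.
  have := le_jump_timeS f n; have := jump_time_ge0 f n; rewrite js.
  by case: (jump_time f n) => [u|//|//]; exists u.
rewrite big_nat_recr//= (ih _ ju) /holding_time ju js.
by rewrite addeC subeK.
Qed.

Lemma cadlag_explosion f t k : minimal_cadlag f -> 0 <= t ->
  f t = Some k -> (t%:E < explosion_time f)%E.
Proof.
by move=> [_ _ f3] t0 ft; rewrite ltNge; apply/negP => /(f3 _ t0); rewrite ft.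
Qed.

(** If state 0 is reached at all, then some state of the jump chain is [<= a];
    the first such state is entered exactly at the first passage time, and the
    holding times before it add up to that jump time.  For a path that
    never gets down to [a] the sum could be a finite explosion time. *)
Lemma first_passage_sum_holding a f : minimal_cadlag f ->
  (first_passage_below 0 f < +oo)%E ->
  (first_passage_below a f =
   \sum_(n <oo) if stays_above a f n then holding_time f n else 0)%E.
Proof.
move=> cf /ereal_inf_lt[_ [t [t0 tz [k ft k0]] <-] _].
have [n tn] := jump_index t0 tz.
have Yn := path_between_jumps tn.
have exN : exists m, ~~ above a (jump_chain f m).
  by exists n; rewrite -Yn ft/= -leqNgt (leq_trans k0).
have [N YN minN] := ex_minnP exN.
have Nn : (N <= n)%N by apply: minN; rewrite -Yn ft/= -leqNgt (leq_trans k0).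
have JNt : (jump_time f N <= t%:E)%E.
  by move: tn => /andP[+ _]; apply: le_trans; exact: jump_time_nd.
have [s js] : exists s, jump_time f N = s%:E.
  have := jump_time_ge0 f N; move: JNt.
  by case: (jump_time f N) => [u|//|//]; exists u.
have s0 : 0 <= s by rewrite -lee_fin -js jump_time_ge0.
have sz : (s%:E < explosion_time f)%E by rewrite (le_lt_trans _ tz)// -js.
(* N is the first index with Y_N <= a, and s is the N-th jump time; s lies
   before the explosion because N comes no later than the visit of 0 *)
have -> : first_passage_below a f = s%:E.
  apply/eqP; rewrite eq_le; apply/andP; split.
    apply: ereal_inf_lbound; exists s => //; split => //.
    move: YN; rewrite (jump_chain_at js).
    have [f1 _ _] := cf; have [+ _] := f1 _ s0 sz.
    by case: (f s) => // j _ /=; rewrite -leqNgt; exists j.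
  apply: le_ereal_inf_tmp => _ [u [u0 uz [j fu ja]] <-].
  have [m um] := jump_index u0 uz.
  move: (um) => /andP[+ _]; apply: le_trans; rewrite -js; apply: jump_time_nd.
  by apply: minN; rewrite -(path_between_jumps um) fu/= -leqNgt.
have stN m : stays_above a f m = (m < N)%N.
  apply/stays_aboveP/idP => [H|mN j jm].
    by rewrite ltnNge; apply: contra YN => /H.
  apply: contraT => /minN; rewrite leqNgt.
  by rewrite (leq_ltn_trans jm).
rewrite (nneseries_split _ N); last first.
  by move=> m _; case: ifPn => // _; exact: holding_time_ge0.
rewrite add0n [X in (_ + X)%E]eseries0 => [|m Nm _]; last by rewrite stN ltnNge Nm.
rewrite adde0 -(sum_holding_time js).
by apply: eq_big_nat => m /andP[_ mN]; rewrite stN mN.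
Qed.

End Passage.

Section PassageMeasurable.
Context d (T : measurableType d) (R : realType).
Variable X : R -> T -> option nat.
Hypothesis mX : forall (t : R) (i : option nat), 0 <= t ->
  measurable [set w | X t w = i].
Hypothesis cX : forall w : T, minimal_cadlag (X ^~ w).

Lemma measurable_first_passage a :
  measurable_fun setT (fun w => first_passage_below a (X ^~ w)).
Proof.
apply: measurable_debut => [w t [t0 tz [k Xt ka]]|t].
  have [e te He] := cadlag_right_itv (cX w) t0.
  exists e => // s ts; have := He _ ts; rewrite Xt => Xs.
  have s0 : 0 <= s by move: ts => /andP[/ltW/(le_trans t0)].
  by split=> //; [exact: cadlag_explosion Xs|exists k].
have [t0|t0] := leP 0 t; last first.
  rewrite [X in measurable X](_ : _ = set0)//; apply/seteqP; split=> w //=.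
  by case.
rewrite [X in measurable X](_ : _ =
    \bigcup_(k in [set k | (k <= a)%N]) [set w | X t w = Some k]).
  by apply: bigcup_measurable => k _; exact: mX.
apply/seteqP; split=> w /=; first by move=> [_ _ [k Xt ka]]; exists k.
move=> [k /= ka Xt]; split=> //; last by exists k.
exact: cadlag_explosion Xt.
Qed.

Lemma measurable_holding_time n :
  measurable_fun setT (fun w => holding_time (X ^~ w) n).
Proof.
have [mJ _] := measurable_jump mX cX n.
have [mJS _] := measurable_jump mX cX n.+1.
rewrite [X in measurable_fun _ X](_ : _ = fun w =>
  if (jump_time (X ^~ w) n < +oo)%E then
    (jump_time (X ^~ w) n.+1 - jump_time (X ^~ w) n)%E else +oo%E).
  apply: measurable_fun_ifT => //.
    exact: measurable_fun_lte.
  exact: emeasurable_funB.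
apply/funext => w; rewrite /holding_time; have := jump_time_ge0 (X ^~ w) n.
by case: (jump_time (X ^~ w) n) => [s|//|//] _; rewrite ltry.
Qed.

End PassageMeasurable.

(** * The jump chain killed at the first passage *)

Section Visits.
Variables (R : realType) (Q : nat -> nat -> R).
Context d (T : measurableType d).
Variables (P : nat -> probability T R) (X : R -> T -> option nat).
Hypothesis HX : minimal_markov_chain Q P X.

Let Y n w := jump_chain (X ^~ w) n.

Let cX w : minimal_cadlag (X ^~ w). Proof. by case: HX. Qed.

Lemma measurable_state n o : measurable [set w | jump_chain (X ^~ w) n = o].
Proof. by case: HX => mX _ _ _; exact: (measurable_jump mX cX n).2. Qed.

Definition path_event n (y : nat -> nat) :=
  [set w | forall k, (k <= n)%N -> jump_chain (X ^~ w) k = Some (y k)].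

Lemma measurable_path_event n y : measurable (path_event n y).
Proof.
rewrite [X in measurable X](_ : _ = \bigcap_(k in [set k | (k <= n)%N])
    [set w | jump_chain (X ^~ w) k = Some (y k)]).
  by apply: bigcap_measurableType => k _; exact: measurable_state.
by apply/seteqP; split.
Qed.

Variable a : nat.

Definition visit n i : set T := [set w |
  stays_above a (X ^~ w) n /\ jump_chain (X ^~ w) n = Some i].

Lemma measurable_above k : measurable [set w | above a (jump_chain (X ^~ w) k)].
Proof.
rewrite [X in measurable X](_ : _ = \bigcup_(i in [set i | (a < i)%N])
    [set w | jump_chain (X ^~ w) k = Some i]).
  by apply: bigcup_measurable => i _; exact: measurable_state.
apply/seteqP; split => w /=; last by move=> [i /= ai ->].
by case E : (jump_chain (X ^~ w) k) => [i|//] /= ai; exists i.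
Qed.

Lemma measurable_stays n : measurable [set w | stays_above a (X ^~ w) n].
Proof.
rewrite [X in measurable X](_ : _ = \bigcap_(k in [set k | (k <= n)%N])
    [set w | above a (jump_chain (X ^~ w) k)]).
  by apply: bigcap_measurableType => k _; exact: measurable_above.
apply/seteqP; split => w /=; first by move=> /stays_aboveP.
by move=> H; apply/stays_aboveP.
Qed.

Lemma measurable_visit n i : measurable (visit n i).
Proof. by apply: measurableI; [exact: measurable_stays|exact: measurable_state]. Qed.

Section VisitInd.
Variables (x n i : nat) (D : set T) (c : R).
Hypotheses (mD : measurable D)
  (HD : forall y, y n = i ->
     (P x (path_event n y `&` D) = P x (path_event n y) * c%:E)%E).

(* the first m coordinates of the jump chain are prescribed, the others are
   only required to stay above a *)
Let H m (y : nat -> nat) := [set w |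
  [/\ forall k, (k < m)%N -> Y k w = Some (y k),
      forall k, (m <= k <= n)%N -> above a (Y k w) & Y n w = Some i]].

Let upd (y : nat -> nat) m j k := if k == m then j else y k.

Let HS m y : (m <= n)%N ->
  H m y = \bigcup_(j in [set j | (a < j)%N]) H m.+1 (upd y m j).
Proof.
move=> mn; apply/seteqP; split => w /=.
  move=> [H1 H2 H3]; have := H2 m; rewrite leqnn mn => /(_ isT).
  case E : (Y m w) => [j|//] /= aj; exists j => //; split => //.
    move=> k; rewrite ltnS leq_eqVlt /upd; have [->//|km /= mk] := eqVneq k m.
    exact: H1.
  by move=> k /andP[mk kn]; apply: H2; rewrite kn ltnW.
move=> [j /= aj [H1 H2 H3]]; split=> //.
  move=> k km; have := H1 k (ltnW km); rewrite /upd.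
  by rewrite ltn_eqF.
move=> k; rewrite leq_eqVlt => /andP[/orP[/eqP <-|mk] kn].
  by rewrite (H1 m (ltnSn m)) /upd eqxx.
by apply: H2; rewrite mk.
Qed.

Let mH m y : measurable (H m y).
Proof.
rewrite [X in measurable X](_ : _ =
   (\bigcap_(k in [set k | (k < m)%N]) [set w | Y k w = Some (y k)]) `&`
   (\bigcap_(k in [set k | (m <= k <= n)%N]) [set w | above a (Y k w)]) `&`
   [set w | Y n w = Some i]).
  apply: measurableI; last exact: measurable_state.
  apply: measurableI; apply: bigcap_measurableType => k _.
    exact: measurable_state.
  exact: measurable_above.
apply/seteqP; split => w /=; first by move=> [? ? ?].
by move=> [[? ?] ?].
Qed.

Let visit_prefix k m y : (m + k = n.+1)%N ->
  (P x (H m y `&` D) = P x (H m y) * c%:E)%E.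
Proof.
elim: k m y => [|k ih] m y.
  rewrite addn0 => ->; have [yi|yi] := eqVneq (y n) i.
    suff -> : H n.+1 y = path_event n y by exact: HD.
    apply/seteqP; split => w /=; first by move=> [].
    move=> H1; split=> //; last by rewrite -yi; exact: H1.
    by move=> j /andP[nj jn]; move: (leq_trans nj jn); rewrite ltnn.
  suff -> : H n.+1 y = set0 by rewrite set0I measure0 mul0e.
  apply/seteqP; split => w //= -[/(_ n (ltnSn n)) -> _ [yiE]].
  by move: yi; rewrite yiE eqxx.
move=> mkn; have mn : (m <= n)%N.
  by rewrite -ltnS -mkn -addSnnS leq_addr.
have triv : trivIset [set j | (a < j)%N] (fun j => H m.+1 (upd y m j)).
  move=> j1 j2 _ _ [w [/= [h1 _ _] [h2 _ _]]].
  have := h1 m (ltnSn m); rewrite (h2 m (ltnSn m)) /upd eqxx.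
  by case.
rewrite HS// setI_bigcupl !measure_bigcup//; last 2 first.
- by move=> j _; exact: measurableI.
- exact: trivIset_setIr.
rewrite muleC -nneseriesZl//.
apply: eq_eseriesr => j _; rewrite muleC; apply: ih.
by rewrite addSnnS.
Qed.

(** The prescribed finite-dimensional laws concern single paths of the jump
    chain.  This lemma sums them over all paths that stay above [a] and end in
    [i]: a conditional probability [c] that depends on the last state only
    survives the summation.  The summation is done one coordinate at a time,
    from the last one backwards, so that only countable unions over the
    naturals occur. *)
Lemma visit_cond : (P x (visit n i `&` D) = P x (visit n i) * c%:E)%E.
Proof.
have -> : visit n i = H 0 (fun=> 0%N).
  apply/seteqP; split => w /= [].
    by move=> /stays_aboveP st Yi; split.
  by move=> _ st Yi; split => //; apply/stays_aboveP => k kn; exact: st.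
exact: (@visit_prefix n.+1).
Qed.

End VisitInd.


Lemma visit_below x n i : (i <= a)%N -> P x (visit n i) = 0%E.
Proof.
move=> ia; rewrite (_ : visit n i = set0) ?measure0//.
apply/seteqP; split => w //= -[/stays_aboveP/(_ n (leqnn n)) + Yi].
by rewrite Yi/= ltnNge ia.
Qed.

Lemma visit0 x i : (a < x)%N -> P x (visit 0 i) = (i == x)%:R%:E.
Proof.
move=> ax; case: HX => _ _ + _ => /(_ x 0%N (fun=> i)).
rewrite big_ord0 mulr1 => <-; have [ix|xi] := leqP i a; last first.
  congr (P x _); apply/seteqP; split => w /=.
    by move=> [_ H] k; rewrite leqn0 => /eqP ->.
  move=> H; split; last by rewrite H.
  by apply/stays_aboveP => k; rewrite leqn0 => /eqP ->; rewrite H.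
rewrite visit_below//; case: HX => _ _ -> _.
by rewrite (ltn_eqF (leq_ltn_trans ix ax)) mul0r.
Qed.

Lemma path_event_jump x n y j :
  (P x (path_event n y `&` [set w | jump_chain (X ^~ w) n.+1 = Some j]) =
   P x (path_event n y) * (jump_matrix Q (y n) j)%:E)%E.
Proof.
case: HX => _ _ H _.
pose y' k := if k == n.+1 then j else y k.
have y'E k : (k <= n)%N -> y' k = y k by move=> kn; rewrite /y' ltn_eqF.
have y'n : y' n.+1 = j by rewrite /y' eqxx.
have -> : path_event n y `&` [set w | jump_chain (X ^~ w) n.+1 = Some j] =
          path_event n.+1 y'.
  apply/seteqP; split => w /=.
    move=> [Hy Yj] k; rewrite leq_eqVlt => /orP[/eqP ->|]; first by rewrite y'n.
    by move=> kn; rewrite y'E//; exact: Hy.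
  move=> Hy; split; last by rewrite Hy// y'n.
  by move=> k kn; rewrite Hy ?y'E// leqW.
rewrite /path_event !H big_ord_recr/= -EFinM y'n !y'E// mulrA.
congr (_ * _ * _)%:E; apply: eq_bigr => k _.
by rewrite !y'E// ltnW.
Qed.

(** The law of the chain prescribes all holding times jointly; taking level 0
    for all but the last one loses only the paths with a vanishing holding
    time, which are negligible. *)
Lemma path_event_hold x n y (v : R) : 0 <= v ->
  (P x (path_event n y `&` [set w | (v%:E < holding_time (X ^~ w) n)%E]) =
   P x (path_event n y) * (expR (- (exit_rate Q (y n) * v)))%:E)%E.
Proof.
move=> v0; case: HX => _ _ _ H.
pose G (u : nat -> R) := [set w | forall k, (k <= n)%N ->
  jump_chain (X ^~ w) k = Some (y k) /\ ((u k)%:E < holding_time (X ^~ w) k)%E].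
have mG u : measurable (G u).
  rewrite [X in measurable X](_ : _ = \bigcap_(k in [set k | (k <= n)%N])
    ([set w | jump_chain (X ^~ w) k = Some (y k)] `&`
     [set w | ((u k)%:E < holding_time (X ^~ w) k)%E])).
    apply: bigcap_measurableType => k _; apply: measurableI.
      exact: measurable_state.
    rewrite -[X in measurable X]setTI; apply: emeasurable_fun_o_infty => //.
    by case: HX => mX cX' _ _; exact: measurable_holding_time.
  by apply/seteqP; split.
pose D := [set w | (v%:E < holding_time (X ^~ w) n)%E].
have mD : measurable D.
  rewrite -[X in measurable X]setTI; apply: emeasurable_fun_o_infty => //.
  by case: HX => mX cX' _ _; exact: measurable_holding_time.
have G0 : P x (G (fun=> 0)) = P x (path_event n y).
  rewrite /G H//; under eq_bigr do rewrite mulr0 oppr0 expR0.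
  by rewrite big1// mule1.
pose uv k := if k == n then v else 0.
have Guv : P x (G uv) = (P x (path_event n y) *
    (expR (- (exit_rate Q (y n) * v)))%:E)%E.
  rewrite /G H; last by move=> k; rewrite /uv; case: ifP.
  rewrite big_ord_recr/= /uv eqxx big1 ?mul1r// => k _.
  by rewrite (ltn_eqF (ltn_ord k)) mulr0 oppr0 expR0.
rewrite -Guv; apply/eqP; rewrite eq_le; apply/andP; split; last first.
  apply: le_measure; rewrite ?inE//.
    by apply: measurableI => //; exact: measurable_path_event.
  move=> w Gw; split; first by move=> k /Gw[].
  by have [_] := Gw n (leqnn n); rewrite /uv eqxx.
(* the events for levels (0, ..., 0, v) and for the last level alone differ by
   paths on which some holding time is not positive *)
have null : P x (path_event n y `\` G (fun=> 0)) = 0%E.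
  rewrite measureD//=; last by rewrite ltey_eq fin_num_measure//; exact: measurable_path_event.
    rewrite setIidr ?G0 ?subee// ?fin_num_measure//; first exact: measurable_path_event.
    by move=> w Gw k /Gw[].
  exact: measurable_path_event.
apply: (@le_trans _ _ (P x (G uv `|` (path_event n y `\` G (fun=> 0))))).
  apply: le_measure; rewrite ?inE//.
  - by apply: measurableI => //; exact: measurable_path_event.
  - apply: measurableU => //; apply: measurableD => //.
    exact: measurable_path_event.
  move=> w [yw Dw]; have [Gw|Gw] := pselect (G (fun=> 0) w); last by right.
  left => k kn; split; first exact: yw.
  by rewrite /uv; case: eqP => [->//|_]; have [] := Gw k kn.
rewrite (le_trans (measureU2 _ _ _))//.
  by apply: measurableD => //; exact: measurable_path_event.
by rewrite [X in (_ + X <= _)%E]null adde0.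
Qed.

Lemma visit_jump x n i j :
  (P x (visit n i `&` [set w | jump_chain (X ^~ w) n.+1 = Some j]) =
   P x (visit n i) * (jump_matrix Q i j)%:E)%E.
Proof.
apply: visit_cond; first exact: measurable_state.
by move=> y <-; exact: path_event_jump.
Qed.

Lemma visit_hold x n i (v : R) : 0 <= v ->
  (P x (visit n i `&` [set w | (v%:E < holding_time (X ^~ w) n)%E]) =
   P x (visit n i) * (expR (- (exit_rate Q i * v)))%:E)%E.
Proof.
move=> v0; apply: visit_cond; last by move=> y <-; exact: path_event_hold.
rewrite -[X in measurable X]setTI; apply: emeasurable_fun_o_infty => //.
by case: HX => mX cX' _ _; exact: measurable_holding_time.
Qed.

Lemma stays_aboveS f n : stays_above a f n.+1 =
  stays_above a f n && above a (@jump_chain R f n.+1).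
Proof.
apply/stays_aboveP/andP => [H|[/stays_aboveP H1 H2] k].
  by split; [apply/stays_aboveP => k kn; apply: H; exact: leqW|exact: H].
by rewrite leq_eqVlt => /orP[/eqP -> //|]; exact: H1.
Qed.

(** Chapman-Kolmogorov for the killed jump chain. *)
Lemma visitS x n j : (a < j)%N ->
  P x (visit n.+1 j) = (\sum_(i <oo) P x (visit n i) * (jump_matrix Q i j)%:E)%E.
Proof.
move=> aj.
under eq_eseriesr do rewrite -visit_jump.
rewrite (_ : visit n.+1 j = \bigcup_i
   (visit n i `&` [set w | jump_chain (X ^~ w) n.+1 = Some j])).
  rewrite measure_bigcup//; first by apply: eq_eseriesl => i; rewrite in_setT.
    move=> i _; apply: measurableI; first exact: measurable_visit.
    exact: measurable_state.
  move=> i1 i2 _ _ [w [[[_ h1] _] [[_ h2] _]]].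
  by move: h1; rewrite h2 => -[].
apply/seteqP; split => w.
  move=> [+ Yj]; rewrite stays_aboveS => /andP[st _].
  have /stays_aboveP/(_ n (leqnn n)) := st.
  by case E : (jump_chain (X ^~ w) n) => [i|//] _; exists i.
move=> [i _ [[st _] Yj]]; split => //.
by rewrite stays_aboveS st [jump_chain _ _]Yj.
Qed.

Lemma sum_visit x n :
  P x [set w | stays_above a (X ^~ w) n] = (\sum_(i <oo) P x (visit n i))%E.
Proof.
rewrite (_ : [set w | _] = \bigcup_i visit n i).
  rewrite measure_bigcup//; first by apply: eq_eseriesl => i; rewrite in_setT.
    by move=> i _; exact: measurable_visit.
  by move=> i1 i2 _ _ [w [[_ h1] [_ h2]]]; move: h1; rewrite h2 => -[].
apply/seteqP; split => w.
  move=> st; have /stays_aboveP/(_ n (leqnn n)) := st.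
  by case E : (jump_chain (X ^~ w) n) => [i|//] _; exists i.
by move=> [i _ []].
Qed.

End Visits.

(** * The mean first passage time as a Green sum *)

Section Tail.
Context d (T : measurableType d) (R : realType) (P : probability T R).

(** Tail formula for a function with values in the extended reals, by
    Tonelli's theorem on the region under the graph. *)
Lemma ge0_integral_tail (D : set T) (f : T -> \bar R) :
  measurable D -> measurable_fun setT f -> (forall w, 0 <= f w)%E ->
  (\int[P]_(w in D) f w = \int[@lebesgue_measure R]_(v in `[0%R, +oo[)
     P (D `&` [set w | v%:E < f w]))%E.
Proof.
move=> mD mf f0.
pose A : set (T * measurableTypeR R) :=
  [set p | [/\ D p.1, 0 <= p.2 & (p.2%:E < f p.1)%E]].
have mA : measurable A.
  rewrite (_ : A = (fst @^-1` D) `&` (snd @^-1` `[0, +oo[) `&`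
     [set p | (p.2%:E < f p.1)%E]).
    apply: measurableI; first apply: measurableI.
    - by rewrite -[X in measurable X]setTI; exact: measurable_fst.
    - rewrite -[X in measurable X]setTI; apply: measurable_snd => //.
    - rewrite -[X in measurable X]setTI; apply: measurable_lte => //.
        by apply/measurable_EFinP; exact: measurable_snd.
      exact: (measurableT_comp mf measurable_fst).
  apply/seteqP; split => -[w v] /=.
    by move=> [? ? ?]; split=> //; split=> //=; rewrite in_itv/= andbT.
  by move=> [[? +] ?]; rewrite /= in_itv/= andbT => ?.
transitivity (\int[P]_w \int[@lebesgue_measure R]_v (\1_A (w, v))%:E)%E.
  rewrite integral_mkcond; apply: eq_integral => w _.
  rewrite patchE; case: ifPn => [/set_mem Dw|/negP Dw]; last first.
    rewrite integral0_eq// => v _; rewrite indicE memNset//= => -[/= ? _ _].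
    by apply: Dw; apply/mem_set.
  transitivity (\int[@lebesgue_measure R]_v
     (\1_([set v | 0 <= v /\ (v%:E < f w)%E] : set R) v)%:E)%E.
    have := f0 w; case: (f w) => [r| |//] r0.
      rewrite (_ : [set v | _] = `[0, r[%classic); last first.
        by apply/seteqP; split=> v /=; rewrite in_itv/= lte_fin;
          [move=> [-> ->]|move=> /andP[]].
      rewrite integral_indic// setIT.
      apply/esym; apply: (etrans (lebesgue_measure_itv (`[0, r[ : interval R))) => /=.
      move: r0; rewrite lee_fin lte_fin le_eqVlt.
      by case/orP=> [/eqP <-|->]; rewrite ?ltxx ?sube0.
    rewrite (_ : [set v | _] = `[0, +oo[%classic); last first.
      by apply/seteqP; split=> v /=; rewrite in_itv/= andbT ltry; [move=> []|].
    rewrite integral_indic// setIT.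
    by apply/esym; apply: (etrans (lebesgue_measure_itv (`[0, +oo[ : interval R))); rewrite /= ltry.
  apply: eq_integral => v _; rewrite !indicE; congr (_ %:R)%:E.
  congr (nat_of_bool _).
  by apply/idP/idP => /set_mem; [move=> [? ?]|move=> [/= ? ? ?]]; apply/mem_set.
rewrite (fubini_tonelli (fun p : T * measurableTypeR R => (\1_A p)%:E))//=; last first.
  by apply/measurable_EFinP; exact: measurable_indic.
rewrite [RHS]integral_mkcond; apply: eq_integral => v _.
rewrite patchE; case: ifPn => [|].
  rewrite inE/= in_itv/= andbT => v0.
  transitivity (\int[P]_w (\1_(D `&` [set w | ((v : R)%:E < f w)%E]) w)%:E)%E; last first.
    rewrite integral_indic// ?setIT//; apply: measurableI => //.
    by rewrite -[X in measurable X]setTI; exact: emeasurable_fun_o_infty.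
  apply: eq_integral => w _; rewrite !indicE; congr (_ %:R)%:E.
  congr (nat_of_bool _).
  by apply/idP/idP => /set_mem; [move=> [? ? ?]|move=> [? ?]]; apply/mem_set.
move=> /negP v0; apply: integral0_eq => w _; rewrite indicE memNset//= => -[/= _ + _].
by move=> v0'; apply: v0; rewrite inE/= in_itv/= v0'.
Qed.
End Tail.

Lemma integral_expRN (R : realType) (q : R) : 0 < q ->
  (\int[@lebesgue_measure R]_(v in `[0%R, +oo[) (expR (- (q * v)))%:E =
   (q^-1)%:E)%E.
Proof.
move=> q0.
transitivity ((q^-1)%:E *
    (\int[@lebesgue_measure R]_v (exponential_pdf q v)%:E))%E; last first.
  by rewrite (integral_exponential_pdf q0) mule1.
rewrite -ge0_integralZl_EFin//; last 3 first.
- by move=> v _; rewrite lee_fin exponential_pdf_ge0// ltW.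
- by apply/measurable_EFinP; exact: measurable_exponential_pdf.
- by rewrite invr_ge0 ltW.
rewrite [LHS]integral_mkcond; apply: eq_integral => v _.
rewrite /exponential_pdf !patchE; case: ifPn => _; last by rewrite mule0.
by rewrite -EFinM mulrA mulVf ?mul1r ?mulNr// gt_eqF.
Qed.

Section MeanPassage.
Variables (R : realType) (Q : nat -> nat -> R).
Context d (T : measurableType d).
Variables (P : nat -> probability T R) (X : R -> T -> option nat).
Hypothesis HX : minimal_markov_chain Q P X.
Variables (a x : nat).

Let mX : forall (t : R) (i : option nat), 0 <= t ->
  measurable [set w | X t w = i].
Proof. by case: HX. Qed.

Let cX w : minimal_cadlag (X ^~ w). Proof. by case: HX. Qed.

Local Open Scope ereal_scope.

(** Given the state [i] of the jump chain, the holding time is exponential with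
    mean [(exit_rate Q i)^-1]. *)
Lemma integral_holding_visit n i : (0 < exit_rate Q i)%R ->
  \int[P x]_(w in visit X a n i) holding_time (X ^~ w) n =
  P x (visit X a n i) * ((exit_rate Q i)^-1)%:E.
Proof.
move=> q0; rewrite ge0_integral_tail; last 3 first.
- exact: measurable_visit HX _ _ _.
- exact: measurable_holding_time.
- by move=> w; exact: holding_time_ge0.
rewrite -integral_expRN// -ge0_integralZl//; last first.
  apply/measurable_EFinP/measurable_funTS; apply: measurableT_comp => //.
  by apply: measurableT_comp => //; exact: measurable_funM.
apply: eq_integral => v; rewrite inE/= in_itv/= andbT => v0.
by rewrite -(visit_hold HX a x n i v0).
Qed.

Hypothesis Hext : P x [set w | first_passage_below 0 (X ^~ w) < +oo] = 1.

Let Om := [set w | first_passage_below 0 (X ^~ w) < +oo].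

Let mOm : measurable Om.
Proof.
rewrite -[X in measurable X]setTI; apply: emeasurable_fun_infty_o => //.
exact: measurable_first_passage.
Qed.

Let negl : (P x).-negligible (~` Om).
Proof.
exists (~` Om); split=> //; first exact: measurableC.
by have := probability_setC (P x) mOm; rewrite Hext subee.
Qed.

(** Almost surely the first passage time is the sum of the holding times before
    it; splitting according to the visited state gives the Green function of
    the killed jump chain, integrated against the mean holding times. *)
Lemma mean_first_passage :
  (forall i, (a < i)%N -> (0 < exit_rate Q i)%R) ->
  \int[P x]_w first_passage_below a (X ^~ w) =
  \sum_(n <oo) \sum_(i <oo) P x (visit X a n i) * ((exit_rate Q i)^-1)%:E.
Proof.
move=> q0.
pose g w := \sum_(n <oo)
  (fun w => holding_time (X ^~ w) n) \_ [set w | stays_above a (X ^~ w) n] w.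
have mg n : measurable_fun setT ((fun w => holding_time (X ^~ w) n)
    \_ [set w | stays_above a (X ^~ w) n]).
  apply/measurable_restrict => //; first exact: measurable_stays HX _ _.
  by apply: measurable_funTS; exact: measurable_holding_time.
have g0 n w : 0 <= ((fun w => holding_time (X ^~ w) n)
    \_ [set w | stays_above a (X ^~ w) n]) w.
  by apply: erestrict_ge0 => {}w _; exact: holding_time_ge0.
transitivity (\int[P x]_w g w).
  apply: ge0_ae_eq_integral => //.
  - exact: measurable_first_passage.
  - exact: ge0_emeasurable_sum.
  - move=> w _; apply: le_ereal_inf_tmp => _ [t [t0 _ _] <-].
    by rewrite lee_fin.
  - by move=> w _; exact: nneseries_ge0.
  apply: negligibleS negl => w /= H Omw; apply: H => _.
  rewrite (first_passage_sum_holding a (cX w))// /g.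
  apply: eq_eseriesr => n _; rewrite patchE; congr (if _ then _ else _).
  by apply/idP/idP => [|/set_mem//]; move/mem_set; apply.
rewrite /g integral_nneseries//; apply: eq_eseriesr => n _.
rewrite -integral_mkcond.
rewrite (_ : [set w | _] = \bigcup_i visit X a n i); last first.
  apply/seteqP; split => w.
    move=> st; have /stays_aboveP/(_ n (leqnn n)) := st.
    by case E : (jump_chain (X ^~ w) n) => [i|//] _; exists i.
  by move=> [i _ []].
rewrite ge0_integral_bigcup//; last 4 first.
- by move=> i; exact: measurable_visit HX _ _ _.
- by apply: measurable_funTS; exact: measurable_holding_time.
- by move=> w _; exact: holding_time_ge0.
- by move=> i1 i2 _ _ [w [[_ h1] [_ h2]]]; move: h1; rewrite h2 => -[].
apply: eq_eseriesr => i _; have [ai|ia] := ltnP a i.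
  by apply: integral_holding_visit; exact: q0.
rewrite visit_below// mul0e.
apply: null_set_integral => //.
- exact: measurable_visit HX _ _ _.
- by apply: measurable_funTS; exact: measurable_holding_time.
- exact: visit_below.
Qed.

(** Since the chain dies out almost surely, it cannot stay above [a] for
    ever. *)
Lemma stays_above_cvg0 :
  P x [set w | stays_above a (X ^~ w) n] @[n --> \oo] --> 0.
Proof.
pose F n := [set w | stays_above a (X ^~ w) n].
have mF n : measurable (F n) by exact: measurable_stays HX _ _.
have mcapF : measurable (\bigcap_n F n) by exact: bigcapT_measurable.
have F0 : P x (\bigcap_n F n) = 0.
  apply/eqP; rewrite eq_le measure_ge0 andbT.
  have := probability_setC (P x) mOm; rewrite Hext subee// => <-.
  apply: le_measure; rewrite ?inE//; first exact: measurableC.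
  move=> w Fw /= /ereal_inf_lt[_ [t [t0 tz [k ft k0]] <-] _].
  have [n tn] := jump_index t0 tz.
  have /stays_aboveP/(_ n (leqnn n)) := Fw n I.
  by rewrite -(path_between_jumps tn) ft/= ltnNge (leq_trans k0).
rewrite -F0; apply: nonincreasing_cvg_mu => //.
  by rewrite ltey_eq fin_num_measure//; exact: mF.
move=> m n mn; apply/subsetPset => w /stays_aboveP st; apply/stays_aboveP => k km.
by apply: st; exact: leq_trans mn.
Qed.

End MeanPassage.

(** * Comparison principles for the Green sum *)

Section Dynkin.
Local Open Scope ereal_scope.
Context (R : realType) (K : nat -> nat -> R) (a x : nat).
Variable u : nat -> nat -> \bar R.
Hypothesis K_ge0 : forall i j, (0 <= K i j)%R.
Hypothesis u_ge0 : forall n i, 0 <= u n i.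
Hypothesis u_fin : forall n i, u n i \is a fin_num.
Hypothesis u0 : forall i, u 0 i = (i == x)%:R%:E.
Hypothesis u_below : forall n i, (i <= a)%N -> u n i = 0.
Hypothesis uS : forall n j, (a < j)%N ->
  u n.+1 j = \sum_(i <oo) u n i * (K i j)%:E.

(** Integration against the law [u n] of the killed chain after [n] steps. *)
Let U n (F : nat -> \bar R) := \sum_(i <oo) u n i * F i.

(** One step of the chain, killed on entering the states up to [a]. *)
Let KF (F : nat -> R) i := \sum_(j <oo | (a < j)%N) (K i j * F j)%:E.

Let U_ge0 n F : (forall i, 0 <= F i) -> 0 <= U n F.
Proof. by move=> F0; apply: nneseries_ge0 => i _ _; apply: mule_ge0. Qed.

Let KF_ge0 F i : (forall i, (0 <= F i)%R) -> 0 <= KF F i.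
Proof. by move=> F0; apply: nneseries_ge0 => j _ _; rewrite lee_fin mulr_ge0. Qed.

Let le_U n F G : (forall i, 0 <= F i) ->
  (forall i, (a < i)%N -> F i <= G i) -> U n F <= U n G.
Proof.
move=> F0 FG; apply: lee_nneseries => i _; first by rewrite mule_ge0.
by have [ai|ia] := ltnP a i; [rewrite lee_wpmul2l// FG|rewrite u_below// !mul0e].
Qed.

Let UD n F G : (forall i, 0 <= F i) -> (forall i, 0 <= G i) ->
  U n (fun i => F i + G i) = U n F + U n G.
Proof.
move=> F0 G0; rewrite -nneseriesD//; last 2 first.
- by move=> i _; rewrite mule_ge0.
- by move=> i _; rewrite mule_ge0.
by apply: eq_eseriesr => i _; rewrite ge0_muleDr.
Qed.

Let U0 F : (forall i, 0 <= F i) -> U 0 F = F x.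
Proof.
move=> F0; rewrite /U (nneseriesD1 (n := x))//; last by move=> i _; rewrite mule_ge0.
rewrite u0 eqxx mul1e eseries0 ?adde0// => i _ /andP[_ /negbTE ix].
by rewrite u0 ix mul0e.
Qed.

Let USK n F : (forall i, (0 <= F i)%R) -> U n.+1 (EFin \o F) = U n (KF F).
Proof.
move=> F0.
transitivity (\sum_(j <oo | (a < j)%N) \sum_(i <oo) u n i * (K i j * F j)%:E).
  rewrite /U [RHS]eseries_mkcond; apply: eq_eseriesr => j _.
  have [aj|ja] := ltnP a j; last by rewrite u_below// mul0e.
  rewrite uS// muleC -nneseriesZl; last by move=> i _; rewrite mule_ge0 ?lee_fin.
  by apply: eq_eseriesr => i _; rewrite muleCA -EFinM mulrC.
rewrite nneseries_interchange; last by move=> j i; rewrite mule_ge0 ?lee_fin ?mulr_ge0.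
apply: eq_eseriesr => i _; rewrite /KF.
have [ai|ia] := ltnP a i; last by rewrite u_below// mul0e eseries0// => j _ _; rewrite mul0e.
rewrite -(fineK (u_fin n i)) -nneseriesZl// => j _.
by rewrite lee_fin mulr_ge0.
Qed.

(** Discrete Dynkin formula as an inequality: along the killed chain the mean
    of [F] drops by at least the mean of [G] at every step, and it stays
    nonnegative. *)
Lemma superharmonic_le (F G : nat -> R) :
  (forall i, (0 <= F i)%R) -> (forall i, (0 <= G i)%R) ->
  (forall i, (a < i)%N -> KF F i + (G i)%:E <= (F i)%:E) ->
  \sum_(n <oo) \sum_(i <oo) u n i * (G i)%:E <= (F x)%:E.
Proof.
move=> F0 G0 FG.
have step n : U n.+1 (EFin \o F) + U n (EFin \o G) <= U n (EFin \o F).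
  rewrite USK// -UD; [|by move=> i; exact: KF_ge0|by move=> i; rewrite lee_fin].
  by apply: le_U => // i; rewrite adde_ge0 ?KF_ge0// lee_fin.
have part n : U n (EFin \o F) + \sum_(0 <= k < n) U k (EFin \o G) <= (F x)%:E.
  elim: n => [|n ih]; first by rewrite big_nil adde0 U0// => i; rewrite lee_fin.
  by rewrite big_nat_recr//= addeCA addeC; apply: le_trans ih; exact: leeD2r.
apply: lime_le.
  by apply: is_cvg_nneseries => n _ _; apply: U_ge0 => i; rewrite lee_fin.
apply: nearW => n; apply: le_trans (part n).
by rewrite leeDr// U_ge0// => i; rewrite lee_fin.
Qed.

Hypothesis u_cvg0 : \sum_(i <oo) u n i @[n --> \oo] --> 0.

(** The reverse inequality needs that no mass of [F] survives in the limit,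
    which holds because [F] is bounded and the chain is eventually killed. *)
Lemma subharmonic_le (F G : nat -> R) (C : R) :
  (forall i, (0 <= F i <= C)%R) -> (forall i, (0 <= G i)%R) ->
  (forall i, (a < i)%N -> (F i)%:E <= KF F i + (G i)%:E) ->
  (F x)%:E <= \sum_(n <oo) \sum_(i <oo) u n i * (G i)%:E.
Proof.
move=> FC G0 FG.
have F0 i : (0 <= F i)%R by have /andP[] := FC i.
have step n : U n (EFin \o F) <= U n.+1 (EFin \o F) + U n (EFin \o G).
  rewrite USK// -UD; [|by move=> i; exact: KF_ge0|by move=> i; rewrite lee_fin].
  by apply: le_U => // i; rewrite lee_fin.
have part n : (F x)%:E <= U n (EFin \o F) + \sum_(0 <= k < n) U k (EFin \o G).
  elim: n => [|n ih]; first by rewrite big_nil adde0 U0// => i; rewrite lee_fin.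
  by rewrite big_nat_recr//= addeCA addeC (le_trans ih)//; exact: leeD2r.
set S := \sum_(n <oo) _.
have S0 : 0 <= S.
  by apply: nneseries_ge0 => n _ _; apply: U_ge0 => i; rewrite lee_fin.
have bnd n : (F x)%:E <= C%:E * \sum_(i <oo) u n i + S.
  apply: (le_trans (part n)); apply: leeD.
    rewrite -nneseriesZl//; apply: lee_nneseries => i _.
      by rewrite mule_ge0 ?lee_fin.
    by rewrite muleC lee_wpmul2r// lee_fin; have /andP[] := FC i.
  by apply: nneseries_lim_ge => k *; apply: nneseries_ge0 => i *; rewrite mule_ge0 ?lee_fin.
have : C%:E * (\sum_(i <oo) u n i) + S @[n --> \oo] --> C%:E * 0 + S.
  apply: cvgeD.
  - by rewrite mule0 fin_num_adde_defr.
  - exact: cvgeZl.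
  - exact: cvg_cst.
rewrite mule0 add0e => cv.
rewrite -(cvg_lim _ cv)//; apply: lime_ge; first by apply/cvg_ex; exists S.
exact: nearW.
Qed.

End Dynkin.

(** * Probability generating functions *)

Section Pgf.
Variables (R : realType) (q : nat -> R).
Hypothesis Hq : is_distribution q.

Let q_ge0 k : 0 <= q k. Proof. by case: Hq. Qed.

Let nd_series (c : nat -> R) : (forall k, 0 <= c k) -> nondecreasing_seq (series c).
Proof.
by move=> c0; apply/nondecreasing_seqP => n; rewrite seriesSr lerDl.
Qed.

Let series_le1 n : series q n <= 1.
Proof.
have [_ q1] := Hq; rewrite -(cvg_lim _ q1)//.
apply: nondecreasing_cvgn_le; first exact: nd_series.
by apply/cvg_ex; exists 1.
Qed.

Lemma pgf_cvg z : 0 <= z <= 1 ->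
  series (fun k => q k * z ^+ k) @ \oo --> pgf_p q z.
Proof.
move=> /andP[z0 z1]; apply: nondecreasing_is_cvgn.
  by apply: nd_series => k; rewrite mulr_ge0// exprn_ge0.
exists 1 => _ [n _ <-]; apply: le_trans (series_le1 n).
by apply: ler_sum => k _; rewrite ler_piMr// exprn_ile1.
Qed.

Lemma pgf1 : pgf_p q 1 = 1.
Proof.
have [_ q1] := Hq; apply/cvg_lim => //.
by under eq_fun do rewrite expr1n mulr1.
Qed.

Lemma pgf_le_sum z (c : R) : 0 <= z <= 1 ->
  (forall n, series (fun k => q k * z ^+ k) n <= c) -> pgf_p q z <= c.
Proof.
move=> z01 H; apply: limr_le; first by apply/cvg_ex; eexists; exact: pgf_cvg z01.
exact: nearW.
Qed.

Lemma pgf_ge0 z : 0 <= z <= 1 -> 0 <= pgf_p q z.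
Proof.
move=> z01; apply: limr_ge; first by apply/cvg_ex; eexists; exact: pgf_cvg z01.
by apply: nearW => n; apply: sumr_ge0 => k _; rewrite mulr_ge0// exprn_ge0//; case/andP: z01.
Qed.

Lemma le_pgf z u : 0 <= z -> z <= u -> u <= 1 -> pgf_p q z <= pgf_p q u.
Proof.
move=> z0 zu u1; have u0 := le_trans z0 zu; have z1 := le_trans zu u1.
apply: (ler_cvg_to (pgf_cvg _) (pgf_cvg _)); rewrite ?z0 ?u0//.
by apply: nearW => n; apply: ler_sum => k _; rewrite ler_wpM2l// lerXn2r.
Qed.

(** The convexity of the powers on the unit interval, as the chord inequality
    between [z] and 1. *)
Lemma exprn_chord (z u : R) k : 0 <= z -> z <= u -> u <= 1 ->
  (1 - z) * u ^+ k <= (1 - u) * z ^+ k + (u - z).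
Proof.
move=> z0 zu u1; have u0 := le_trans z0 zu; have z1 := le_trans zu u1.
elim: k => [|k ih]; first by rewrite !expr0; lra.
have zk1 : z ^+ k <= 1 by rewrite exprn_ile1.
have := ler_wpM2l u0 ih; rewrite !exprS => ih'.
have h : 0 <= (1 - u) * ((u - z) * (1 - z ^+ k)).
  by rewrite !mulr_ge0// subr_ge0.
by move: ih' h; move: (z ^+ k) (u ^+ k) => zk uk; nra.
Qed.

Lemma pgf_chord z u : 0 <= z -> z <= u -> u <= 1 ->
  (1 - z) * pgf_p q u <= (1 - u) * pgf_p q z + (u - z).
Proof.
move=> z0 zu u1; have u0 := le_trans z0 zu; have z1 := le_trans zu u1.
have cu : (1 - z) * series (fun k => q k * u ^+ k) n @[n --> \oo] -->
    (1 - z) * pgf_p q u by apply: cvgMr; apply: pgf_cvg; rewrite u0.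
have [_ q1] := Hq.
have cz : (1 - u) * series (fun k => q k * z ^+ k) n + (u - z) * series q n
    @[n --> \oo] --> (1 - u) * pgf_p q z + (u - z) * 1.
  apply: cvgD; apply: cvgMr => //; apply: pgf_cvg; by rewrite z0.
rewrite -[u - z]mulr1; apply: (ler_cvg_to cu cz).
apply: nearW => n; rewrite !mulr_sumr -big_split/=; apply: ler_sum => k _.
rewrite !(mulrCA _ (q k)) [(u - z) * _]mulrC -mulrDr ler_wpM2l//.
exact: exprn_chord.
Qed.

(** Convexity bounds the slope at [z] by that of the chord from [u] to 1, and
    the values stay in the unit interval; this local Lipschitz bound replaces
    the differentiation of the power series. *)
Lemma pgf_lip z u : 0 <= z -> z <= u -> u < 1 ->
  `|pgf_p q u - pgf_p q z| <= (u - z) / (1 - u).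
Proof.
move=> z0 zu u1; rewrite ger0_norm ?subr_ge0; last exact: (le_pgf z0 zu (ltW u1)).
have := pgf_chord z0 zu (ltW u1).
have : 0 <= pgf_p q z.
  by apply: pgf_ge0; rewrite z0 ltW// (le_lt_trans zu).
have : pgf_p q z <= pgf_p q u by apply: le_pgf => //; exact: ltW.
rewrite ler_pdivlMr ?subr_gt0//; move: (pgf_p q z) (pgf_p q u) => A B.
by nra.
Qed.

Lemma continuous_pgf z : 0 < z < 1 -> {for z, continuous (pgf_p q)}.
Proof.
move=> /andP[z0 z1]; apply/cvgrPdist_le => e e0.
pose s := (z + 1) / 2.
have s1 : s < 1 by rewrite /s; lra.
have zs : z < s by rewrite /s; lra.
have h0 : 0 < e * (1 - s) by rewrite mulr_gt0// subr_gt0.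
near=> u.
have u0 : 0 < u by near: u; exact: lt_nbhsr.
have us : u < s by near: u; exact: lt_nbhsl.
have zu : `|z - u| <= e * (1 - s).
  by near: u; move: h0; move: (e * _); apply/cvgrPdist_le; exact: cvg_id.
have H v w : 0 <= v -> v <= w -> w < s -> `|w - v| <= e * (1 - s) ->
    `|pgf_p q w - pgf_p q v| <= e.
  move=> v0 vw ws wv; apply: (le_trans (pgf_lip v0 vw (lt_trans ws s1))).
  rewrite ler_pdivrMr ?subr_gt0 ?(lt_trans ws)//.
  rewrite (le_trans (ler_norm _))// (le_trans wv)//.
  by apply: ler_wpM2l; [exact: ltW|lra].
have [zlu|ulz] := leP z u; last by apply: H => //; exact: ltW.
rewrite distrC in zu; rewrite distrC.
by apply: H => //; exact: ltW.
Unshelve. all: by end_near. Qed.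

(** A supercritical distribution: strict convexity, from an atom at some
    [k >= 2], puts the midpoint of [z] and 1 strictly below the diagonal.
    Without such an atom the generating function is constantly 1. *)
Lemma pgf_lt_fix z : q 1%N = 0 -> 0 <= z < 1 -> pgf_p q z <= z ->
  exists2 m, 0 < m < 1 & pgf_p q m < m.
Proof.
move=> q1 /andP[z0 z1] zfix.
have m01 : 0 < (z + 1) / 2 < 1 by apply/andP; split; lra.
exists ((z + 1) / 2) => //.
have [k k2 qk] : exists2 k, (1 < k)%N & 0 < q k.
  apply: contrapT => H; suff : pgf_p q z = 1 by lra.
  have qk0 k : (0 < k)%N -> q k = 0.
    move=> k0; apply/eqP; rewrite eq_le q_ge0 andbT leNgt; apply/negP => qk.
    apply: H; exists k => //; case: k k0 qk => [//|[|//]] _.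
    by rewrite q1 ltxx.
  have <- : pgf_p q 1 = 1 by exact: pgf1.
  congr (lim _); congr (_ @ \oo); apply/funext => n; apply: eq_bigr => -[|j] _.
    by rewrite !expr0.
  by rewrite qk0// !mul0r.
set m := _ / 2 in m01 *.
have mE : 2 * m = z + 1 by rewrite /m; lra.
have [m0 m1] : 0 <= m /\ m < 1 by move: m01 => /andP[/ltW].
have weak j : 2 * m ^+ j <= z ^+ j + 1.
  have := @exprn_chord z m j z0 (ltac:(lra)) (ltW m1).
  have -> : m - z = 1 - m by lra.
  have -> : 1 - z = 2 * (1 - m) by lra.
  have m1' : 0 < 1 - m by rewrite subr_gt0.
  by rewrite -[2 * m ^+ j <= _](ler_pM2l m1') [(1 - m) * (_ + 1)]mulrDr mulr1 mulrA [(1 - m) * 2]mulrC.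
have strict j : (1 < j)%N -> 2 * m ^+ j < z ^+ j + 1.
  case: j => [//|[//|j _]]; have := ler_wpM2l m0 (weak j.+1).
  have zj1 : z ^+ j.+1 < 1 by rewrite exprn_ilt1.
  have : 0 < (1 - m) * (1 - z ^+ j.+1) by rewrite mulr_gt0// subr_gt0.
  rewrite (exprS m j.+1) (exprS z j.+1).
  move: (m ^+ j.+1) (z ^+ j.+1) => mj zj; have zE : z = 2 * m - 1 by lra.
  by rewrite {}zE; nra.
pose c j := q j * (z ^+ j + 1 - 2 * m ^+ j).
have c0 j : 0 <= c j by rewrite mulr_ge0// subr_ge0.
have cc : series c @ \oo --> pgf_p q z + 1 - 2 * pgf_p q m.
  have -> : series c = fun n => series (fun k => q k * z ^+ k) n + series q n -
      2 * series (fun k => q k * m ^+ k) n.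
    apply/funext => n; rewrite /series/= -big_split/= mulr_sumr -sumrB.
    by apply: eq_bigr => j _; rewrite /c; ring.
  have [_ qq1] := Hq.
  apply: cvgB; first by apply: cvgD => //; apply: pgf_cvg; rewrite z0 ltW.
  by apply: cvgMr; apply: pgf_cvg; move: m01 => /andP[/ltW -> /ltW].
have : c k <= pgf_p q z + 1 - 2 * pgf_p q m.
  rewrite -(cvg_lim _ cc)//.
  apply: (le_trans _ (nondecreasing_cvgn_le (nd_series c0) _ k.+1)).
    by rewrite seriesSr lerDr sumr_ge0.
  by apply/cvg_ex; eexists; exact: cc.
have : 0 < c k by rewrite mulr_gt0// subr_gt0 strict.
lra.
Qed.

Lemma pgf_le_id z : q 0%N = 0 -> 0 <= z <= 1 -> pgf_p q z <= z.
Proof.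
move=> q0 /andP[z0 z1]; apply: pgf_le_sum; first by rewrite z0.
move=> n; apply: (@le_trans _ _ (z * series q n)); last by rewrite ler_piMr.
rewrite mulr_sumr; apply: ler_sum => -[|k] _; first by rewrite q0 !(mul0r, mulr0).
by rewrite mulrC ler_wpM2r// exprS ler_piMr// exprn_ile1.
Qed.

End Pgf.

(** * The jump matrix acting on powers *)

Section Model.
Variables (R : realType) (lam mu : R) (p : nat -> R) (r : int -> R).
Hypothesis Hpar : admissible lam mu p r.

Let rho k := r (k%:Z - 1).

Let lam0 : 0 < lam. Proof. by case: Hpar. Qed.
Let mu0 : 0 <= mu. Proof. by case: Hpar. Qed.
Let Hp : is_distribution p. Proof. by case: Hpar. Qed.
Let Hr : is_distribution rho. Proof. by case: Hpar. Qed.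
Let p_ge0 k : 0 <= p k. Proof. by case: Hp. Qed.
Let rho_ge0 k : 0 <= rho k. Proof. by case: Hr. Qed.

Lemma pgf_rE z : 0 < z <= 1 -> pgf_r r z = pgf_p rho z / z.
Proof.
move=> /andP[z0 z1]; rewrite /pgf_r mulrC.
apply/cvg_lim => //.
rewrite (_ : series _ = fun n => z^-1 * series (fun k => rho k * z ^+ k) n).
  by apply: cvgMr; apply: pgf_cvg => //; rewrite z1 ltW.
apply/funext => n; rewrite /series/= mulr_sumr; apply: eq_bigr => k _.
by rewrite expfzDr ?gt_eqF// exprN1 mulrA mulrC.
Qed.

(** With [drift_r] below, the generator maps the function [v ^+ n] of the state
    [n] to [n%:R * v ^+ n.-1 * drift_p v - v ^+ n * drift_r v]. *)
Definition drift_p v := lam * (pgf_p p v - v).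
Definition drift_r v := mu * (1 - pgf_r r v).

Let Q := generator lam mu p r.

Lemma exit_rateE n : (0 < n)%N -> exit_rate Q n = lam * n%:R + mu.
Proof.
by move=> n0; rewrite /exit_rate /Q /generator gtn_eqF// eqxx opprK.
Qed.

Lemma exit_rate_gt0 n : (0 < n)%N -> 0 < exit_rate Q n.
Proof. by move=> n0; rewrite exit_rateE// ltr_wpDr// mulr_gt0// ltr0n. Qed.

(** The diagonal entry fits the pattern because [p 1] and [r 0] vanish. *)
Lemma jump_matrix_shift i k : jump_matrix Q i.+1 (i + k) =
  (p k * lam * i.+1%:R + rho k * mu) / exit_rate Q i.+1.
Proof.
have q0 := exit_rate_gt0 (ltn0Sn i).
rewrite /jump_matrix gt_eqF//; case: eqP => [ik|/eqP ik].
  have -> : k = 1%N by lia.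
  have -> : rho 1%N = 0 by rewrite /rho subrr; case: Hpar.
  have -> : p 1%N = 0 by case: Hpar.
  by rewrite !mul0r add0r mul0r.
congr (_ / _); rewrite /Q /generator/= eq_sym (negbTE ik).
rewrite ltnS leq_addr; congr (p _ * _ * _ + r _ * _).
  by rewrite subSS addKn.
by lia.
Qed.

Lemma jump_matrix_down i j : (j < i)%N -> jump_matrix Q i.+1 j = 0.
Proof.
move=> ji; have q0 := exit_rate_gt0 (ltn0Sn i).
have jn : (j == i.+1) = false by rewrite ltn_eqF// leqW.
have nj : (i < j.+1)%N = false by rewrite ltnS leqNgt ji.
by rewrite /jump_matrix gt_eqF// eq_sym jn {1}/Q /generator/= jn nj mul0r.
Qed.

Lemma jump_matrix_ge0 i j : 0 <= jump_matrix Q i j.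
Proof.
case: i => [|i].
  by rewrite /jump_matrix /exit_rate /Q /generator/= oppr0 eqxx.
have [ji|ij] := ltnP j i; first by rewrite jump_matrix_down.
rewrite -(subnKC ij) jump_matrix_shift.
rewrite divr_ge0 ?(ltW (exit_rate_gt0 _))// addr_ge0// !mulr_ge0//.
exact: ltW.
Qed.

(** The jump matrix is the identity plus the generator divided by the exit
    rate. *)
Lemma jump_pgf n v : (0 < n)%N -> 0 < v <= 1 ->
  series (fun j => jump_matrix Q n j * v ^+ j) @ \oo -->
  v ^+ n + (n%:R * v ^+ n.-1 * drift_p v - v ^+ n * drift_r v) / exit_rate Q n.
Proof.
case: n => [//|i _] v01; have /andP[v0 v1] := v01.
have q0 := exit_rate_gt0 (ltn0Sn i).
have v01' : 0 <= v <= 1 by rewrite ltW.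
rewrite -(cvg_shiftn i).
rewrite [X in X @ _ --> _](_ : _ = fun m => v ^+ i / exit_rate Q i.+1 *
  (lam * i.+1%:R * series (fun k => p k * v ^+ k) m +
   mu * series (fun k => rho k * v ^+ k) m)); last first.
  apply/funext => m /=; rewrite /series/= (@big_cat_nat _ _ _ i)//=; last exact: leq_addl.
  rewrite big_nat_cond big1 ?add0r; last first.
    by move=> j /andP[/andP[_ ji] _]; rewrite jump_matrix_down// mul0r.
  rewrite -{1}[i]add0n big_addn addnK !mulr_sumr -big_split/= mulr_sumr.
  apply: eq_bigr => k _; rewrite addnC jump_matrix_shift exprD.
  by move: (exit_rate Q i.+1) q0 => e e0; field; rewrite gt_eqF.
have -> : v ^+ i.+1 + (i.+1%:R * v ^+ i.+1.-1 * drift_p v - v ^+ i.+1 * drift_r v)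
    / exit_rate Q i.+1 = v ^+ i / exit_rate Q i.+1 *
   (lam * i.+1%:R * pgf_p p v + mu * pgf_p rho v).
  rewrite exit_rateE// in q0 *.
  rewrite /drift_p /drift_r pgf_rE//= exprS.
  by field; rewrite nat1r !gt_eqF.
apply: cvgMr; apply: cvgD; apply: cvgMr; exact: pgf_cvg.
Qed.

Lemma continuous_drift_p v : 0 < v < 1 -> {for v, continuous drift_p}.
Proof.
move=> v01; apply: continuousM; first exact: cvg_cst.
apply: continuousB; last exact: cvg_id.
exact: continuous_pgf.
Qed.

Lemma continuous_drift_r v : 0 < v < 1 -> {for v, continuous drift_r}.
Proof.
move=> v01; have /andP[v0 v1] := v01.
apply: continuousM; first exact: cvg_cst.
apply: continuousB; first exact: cvg_cst.
suff : pgf_r r z @[z --> v] --> pgf_r r v by [].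
rewrite (pgf_rE (z := v)) ?v0 ?ltW//.
have : pgf_p rho z / z @[z --> v] --> pgf_p rho v / v.
  by apply: cvgM; [exact: (continuous_pgf Hr v01)|apply: cvgV; rewrite ?gt_eqF//; exact: cvg_id].
apply: cvg_trans; apply: near_eq_cvg; near=> z.
rewrite pgf_rE//; apply/andP; split; first by near: z; exact: lt_nbhsr.
by apply/ltW; near: z; exact: lt_nbhsl.
Unshelve. all: by end_near. Qed.

Lemma drift_r_le v : 0 < v <= 1 -> drift_r v <= mu.
Proof.
move=> v01; have /andP[v0 v1] := v01.
rewrite /drift_r ler_piMr// lerBlDr lerDl pgf_rE// divr_ge0 ?(ltW v0)//.
by apply: (pgf_ge0 Hr); rewrite (ltW v0).
Qed.

(** Between [phi] and 1 the generating function of the shifted law [r] is at most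
    the identity: it is convex and touches the diagonal at [phi] and at 1; when
    [r (-1)] vanishes, this holds on the whole unit interval, termwise. *)
Lemma drift_r_ge0 phi v : is_phi mu r phi -> phi < 1 -> 0 < v -> phi <= v -> v <= 1 ->
  0 <= drift_r v.
Proof.
move=> Hphi phi1 v0 phiv v1.
have v01 : 0 < v <= 1 by rewrite v0.
have [mu00|mun0] := eqVneq mu 0; first by rewrite /drift_r mu00 mul0r.
have mup : 0 < mu by rewrite lt_neqAle eq_sym mun0.
rewrite mulr_ge0// subr_ge0 pgf_rE// ler_pdivrMr// mul1r.
move: Hphi; rewrite /is_phi; case: ifPn => [_ [phi0 rphi _]|r1 phiE].
  move: rphi; rewrite pgf_rE// => rphi.
  have /andP[p0 p1] := phi0.
  have E : pgf_p rho phi = phi by rewrite -[RHS]mul1r -rphi divfK// gt_eqF.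
  have := pgf_chord Hr (ltW p0) phiv v1; rewrite E => H.
  by rewrite -(ler_pM2l (_ : 0 < 1 - phi)) ?subr_gt0//; lra.
have rho0 : rho 0%N = 0.
  apply/eqP; rewrite eq_le rho_ge0 andbT leNgt; apply: contra r1 => r1.
  by rewrite mulr_gt0//; move: r1; rewrite /rho sub0r.
by apply: (pgf_le_id Hr) => //; rewrite ltW.
Qed.
End Model.

(** * Calculus on the open unit interval *)

Section CalculusUnitInterval.
Variable R : realType.
Notation leb := (@lebesgue_measure R).

Lemma within_continuous_segment (b : R -> R) c e :
  (forall v : R, c <= v <= e -> {for v, continuous b}) ->
  {within `[c, e], continuous b}.
Proof.
move=> cb; apply: continuous_in_subspaceT => v; rewrite inE/= in_itv/=.
exact: cb.
Qed.

Lemma integrable_segment (b : R -> R) c e :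
  (forall v : R, c <= v <= e -> {for v, continuous b}) ->
  leb.-integrable `[c, e] (EFin \o b).
Proof.
move=> cb; apply: continuous_compact_integrable; first exact: segment_compact.
exact: within_continuous_segment.
Qed.

(** The base point cannot be 0, where [b] may blow up, so it moves with the
    point; differences of integrals make the choice immaterial. *)
Lemma antiderivative_oo (b : R -> R) :
  (forall v : R, 0 < v < 1 -> {for v, continuous b}) ->
  exists g : R -> R, forall v : R, 0 < v < 1 -> is_derive v 1 g (b v).
Proof.
move=> cb.
pose J e v := (\int[leb]_(t in `[e, v]) b t)%R.
have ib c e : 0 < c -> e < 1 -> leb.-integrable `[c, e] (EFin \o b).
  move=> c0 e1; apply: integrable_segment => v /andP[cv ve]; apply: cb.
  by rewrite (lt_le_trans c0)//= (le_lt_trans ve).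
have JB c e v : 0 < c -> c <= e -> e <= v -> v < 1 -> J c v - J c e = J e v.
  move=> c0 ce ev v1; rewrite /J Rintegral_itvB//.
  - rewrite Rintegral_itv_obnd_cbnd//; apply: integrableS (ib c v c0 v1) => //.
    by apply: subset_itvr; rewrite bnd_simp.
  - exact: ib.
exists (fun v => J (v / 2) v - J (v / 2) (1 / 2)) => v /andP[v0 v1].
(* a base point that is good for all w near v, as v / 4 < w / 2 *)
pose e := v / 4.
have e0 : 0 < e by rewrite /e; lra.
have dJ : is_derive v 1 (J e) (b v).
  have u1 : (v + 1) / 2 < 1 by lra.
  have vu : v < (v + 1) / 2 by lra.
  have ev : e < v by rewrite /e; lra.
  have [d1 d2] := continuous_FTC1_closed vu (ib _ _ e0 u1) ev (cb v ltac:(lra)).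
  by apply: DeriveDef => //; rewrite -derive1E.
have dJ' : is_derive v 1 (fun w => J e w - J e (1 / 2)) (b v).
  by rewrite -[b v]subr0; apply: is_deriveB.
apply: near_eq_is_derive dJ'; near=> w.
have vw : v / 2 < w by near: w; apply: lt_nbhsr; lra.
have ew : e <= w / 2 by rewrite /e; lra.
have w1 : w < 1 by near: w; exact: lt_nbhsl.
by rewrite -(JB e (w / 2) w)// -?(JB e (w / 2) (1 / 2))//; lra.
Unshelve. all: by end_near. Qed.

Lemma FTC2_segment (F f : R -> R) c e : c <= e ->
  (forall v : R, c <= v <= e -> {for v, continuous f}) ->
  (forall v : R, c <= v <= e -> is_derive v 1 F (f v)) ->
  (\int[leb]_(x in `[c, e]) (f x)%:E = (F e - F c)%:E)%E.
Proof.
rewrite le_eqVlt => /predU1P[->|ce] cf dF.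
  by rewrite set_itv1 integral_set1 subrr.
have dF' v : c <= v <= e -> derivable F v 1.
  by move=> /dF [].
have cF v : c <= v <= e -> {for v, continuous F}.
  by move=> /dF' dv; apply/differentiable_continuous/derivable1_diffP.
rewrite EFinB; apply: continuous_FTC2 => //.
- exact: within_continuous_segment.
- split.
  + by move=> v; rewrite in_itv/= => /andP[/ltW cv /ltW ve]; apply: dF'; rewrite cv.
  + by apply: cvg_at_right_filter; apply: cF; rewrite lexx ltW.
  + by apply: cvg_at_left_filter; apply: cF; rewrite lexx ltW.
- move=> v; rewrite in_itv/= => /andP[/ltW cv /ltW ve].
  by rewrite derive1E; have [_ ->] := dF v ltac:(by rewrite cv).
Qed.

Lemma derive_le_homo (F f : R -> R) c e : c <= e ->
  (forall v : R, c <= v <= e -> is_derive v 1 F (f v)) ->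
  (forall v : R, c <= v <= e -> 0 <= f v) -> F c <= F e.
Proof.
move=> ce dF f0.
have dF' v : c <= v <= e -> derivable F v 1 by move=> /dF [].
apply: (@ger0_derive1_le_cc _ F c e) => //.
- by move=> v; rewrite in_itv/= => /andP[/ltW cv /ltW ve]; apply: dF'; rewrite cv.
- move=> v; rewrite in_itv/= => /andP[/ltW cv /ltW ve].
  have cve : c <= v <= e by rewrite cv.
  by rewrite derive1E; have [_ ->] := dF v cve; exact: f0.
- apply: within_continuous_segment => v /dF' dv.
  exact/differentiable_continuous/derivable1_diffP.
- by rewrite in_itv/= lexx ce.
- by rewrite in_itv/= lexx ce.
Qed.

End CalculusUnitInterval.

(** * The potential of the chain on a compact subinterval *)

(** For an antiderivative [beta] of [drift_r / drift_p], this weight turns the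
    action of the generator on [v ^+ n] into the exact derivative of
    [v ^+ n * expR (- beta v)]. *)
Definition weight (R : realType) (lam : R) (p : nat -> R) (beta : R -> R) (v : R) : R :=
  expR (- beta v) / drift_p lam p v.

Section Potential.
Variables (R : realType) (lam mu : R) (p : nat -> R) (r : int -> R).
Hypothesis Hpar : admissible lam mu p r.
Notation leb := (@lebesgue_measure R).

Let A := drift_p lam p.
Let B := drift_r mu r.
Let Q := generator lam mu p r.
Let q := exit_rate Q.

Lemma drift_p1 : drift_p lam p 1 = 0.
Proof. by case: Hpar => _ _ Hp *; rewrite /drift_p (pgf1 Hp) subrr mulr0. Qed.

Lemma drift_r1 : drift_r mu r 1 = 0.
Proof.
rewrite /drift_r (pgf_rE Hpar); last by rewrite ltr01 lexx.
by case: Hpar => _ _ _ _ _ Hr *; rewrite (pgf1 Hr) divr1 subrr mulr0.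
Qed.

(** The killing is invisible to [v ^+ a - v ^+ j]: the chain goes down by
    single steps, so from a state above [a] it can only enter the states up to
    [a] at [a] itself, where the function vanishes. *)
Lemma jump_power_diff a i v : (a < i)%N -> 0 < v <= 1 ->
  (\sum_(j <oo | (a < j)%N) (jump_matrix Q i j * (v ^+ a - v ^+ j))%:E =
   (v ^+ a - v ^+ i - (i%:R * v ^+ i.-1 * A v - v ^+ i * B v) / q i)%:E)%E.
Proof.
move=> ai v01; have i0 : (0 < i)%N by apply: leq_ltn_trans ai.
rewrite eseries_mkcond; apply/cvg_lim => //.
rewrite (_ : (fun n => _) = EFin \o
   (fun n => v ^+ a * series (fun j => jump_matrix Q i j * 1 ^+ j) n -
     series (fun j => jump_matrix Q i j * v ^+ j) n)); last first.
  apply/funext => n /=; rewrite /series/= mulr_sumr -sumrB -sumEFin.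
  apply: eq_bigr => j _; have [aj|ja] := ltnP a j.
    by rewrite expr1n; congr EFin; ring.
  move: ja; rewrite leq_eqVlt => /predU1P[->|ja].
    by rewrite expr1n; congr EFin; ring.
  case: i ai {i0} => [//|i]; rewrite ltnS => ai.
  by rewrite (jump_matrix_down Hpar (leq_trans ja ai)) !mul0r mulr0 subrr.
apply/fine_cvgP; split; first exact: nearW.
have c1 := jump_pgf Hpar i0 (v := 1) ltac:(by rewrite ltr01 lexx).
have cv := jump_pgf Hpar i0 v01.
rewrite drift_p1 drift_r1 !mulr0 subrr mul0r addr0 expr1n in c1.
have -> : v ^+ a - v ^+ i - (i%:R * v ^+ i.-1 * A v - v ^+ i * B v) / q i =
  v ^+ a * 1 - (v ^+ i + (i%:R * v ^+ i.-1 * A v - v ^+ i * B v) / q i).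
  by rewrite mulr1 opprD addrA.
by apply: cvgB => //; apply: cvgMr.
Qed.

Hypothesis A_gt0 : forall v : R, 0 < v < 1 -> 0 < A v.
Variable beta : R -> R.
Hypothesis dbeta : forall v : R, 0 < v < 1 -> is_derive v 1 beta (B v / A v).

Let gam v := expR (- beta v).
Let W := weight lam p beta.

Let cbeta v : 0 < v < 1 -> {for v, continuous beta}.
Proof.
by move=> /dbeta[dv _]; apply/differentiable_continuous/derivable1_diffP.
Qed.

Let cgam v : 0 < v < 1 -> {for v, continuous gam}.
Proof.
move=> v01; apply: continuous_comp; first by apply: continuousN; exact: cbeta.
exact: continuous_expR.
Qed.

Lemma continuous_weight (v : R) : 0 < v < 1 -> {for v, continuous (weight lam p beta)}.
Proof.
move=> v01; apply: continuousM; first exact: cgam.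
apply: continuousV; first by rewrite gt_eqF// A_gt0.
exact: (continuous_drift_p Hpar).
Qed.

Let cX n v : {for v, continuous (fun v : R => v ^+ n)}.
Proof. exact: (@exprn_continuous _ n v). Qed.

Let cdrift n (v : R) : 0 < v < 1 -> {for v, continuous (fun v : R =>
  (n%:R * v ^+ n.-1 * A v - v ^+ n * B v) * W v)}.
Proof.
move=> v01.
apply: continuousM; last exact: continuous_weight.
apply: continuousB; apply: continuousM.
- by apply: continuousM; [exact: cst_continuous|exact: cX].
- exact: (continuous_drift_p Hpar).
- exact: cX.
- exact: (continuous_drift_r Hpar).
Qed.

Lemma weight_gt0 (v : R) : 0 < v < 1 -> 0 < weight lam p beta v.
Proof. by move=> v01; rewrite divr_gt0 ?expR_gt0// A_gt0. Qed.

Lemma integral_drift n e s : 0 < e -> e <= s -> s < 1 ->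
  (\int[leb]_(v in `[e, s])
     ((n%:R * v ^+ n.-1 * A v - v ^+ n * B v) * W v)%:E =
   (s ^+ n * expR (- beta s) - e ^+ n * expR (- beta e))%:E)%E.
Proof.
move=> e0 es s1.
have es01 v : e <= v <= s -> 0 < v < 1.
  by move=> /andP[ev vs]; rewrite (lt_le_trans e0)//= (le_lt_trans vs).
apply: (@FTC2_segment _ (fun v : R => v ^+ n * gam v) (fun v : R =>
  (n%:R * v ^+ n.-1 * A v - v ^+ n * B v) * W v)) => // v /es01 v01.
  exact: cdrift.
have A0 := A_gt0 v01.
have dg : is_derive v 1 gam (gam v * - (B v / A v)).
  have dN : is_derive v 1 (- beta) (- (B v / A v)).
    by apply: is_deriveN; exact: dbeta.
  exact: (@is_derive1_comp _ expR (- beta)).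
have dX : is_derive v 1 (fun v : R => v ^+ n) (n%:R * v ^+ n.-1).
  have -> : (fun v : R => v ^+ n) = id ^+ n.
    by apply/funext => w; rewrite exprfctE.
  by apply: is_derive_eq; rewrite [LHS]mulr1.
apply: (is_derive_eq (is_deriveM dX dg)) => /=.
rewrite /W /weight /gam -/(A v) /GRing.scale/=; field.
by rewrite gt_eqF.
Qed.

Section Fes.
Variables (a : nat) (e s : R).
Hypotheses (e0 : 0 < e) (es : e <= s) (s1 : s < 1).

(** A mixture of the functions [v ^+ a - v ^+ j] of the state [j] for [v]
    from [e] to [s]; away from 0 and 1 all integrands are continuous.  The values
    below [a] are immaterial for the killed chain; zero keeps the function
    nonnegative. *)
Definition potential j : R :=
  if (a < j)%N then \int[leb]_(v in `[e, s]) ((v ^+ a - v ^+ j) * W v) else 0.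

Let es01 v : e <= v <= s -> 0 < v < 1.
Proof. by move=> /andP[ev vs]; rewrite (lt_le_trans e0)//= (le_lt_trans vs). Qed.

Lemma integrable_potential j : leb.-integrable `[e, s] (EFin \o (fun v => (v ^+ a - v ^+ j) * W v)).
Proof.
apply: integrable_segment => v /es01 v01; apply: continuousM; last exact: continuous_weight.
by apply: continuousB; exact: cX.
Qed.

Lemma potentialE j : (a < j)%N ->
  ((potential j)%:E = \int[leb]_(v in `[e, s]) ((v ^+ a - v ^+ j) * W v)%:E)%E.
Proof.
by move=> aj; rewrite /potential aj /Rintegral fineK//; exact: (integrable_fin_num _ (integrable_potential j)).
Qed.

Let diff_ge0 v j : 0 < v < 1 -> (a <= j)%N -> 0 <= (v ^+ a - v ^+ j) * W v.
Proof.
move=> v01 aj; rewrite mulr_ge0 ?(ltW (weight_gt0 v01))// subr_ge0.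
by case/andP: v01 => /ltW v0 /ltW v1; rewrite ler_wiXn2l.
Qed.

Lemma potential_ge0 j : 0 <= potential j.
Proof.
rewrite /potential; case: ifPn => // aj; apply: Rintegral_ge0 => v /=.
by rewrite in_itv/= => /es01 v01; exact: diff_ge0 (ltnW aj).
Qed.

Lemma potential_le j :
  potential j <= \int[leb]_(v in `[e, s]) W v.
Proof.
have iW : leb.-integrable `[e, s] (EFin \o W).
  by apply: integrable_segment => v /es01 v01; exact: continuous_weight.
rewrite /potential; case: ifPn => aj; last first.
  apply: Rintegral_ge0 => v /=; rewrite in_itv/= => /es01 v01.
  exact/ltW/weight_gt0.
apply: le_Rintegral => //; first exact: integrable_potential.
move=> v /=; rewrite in_itv/= => /es01 v01.
rewrite ler_piMl ?(ltW (weight_gt0 v01))//.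
case/andP: v01 => /ltW v0 /ltW v1.
by rewrite lerBlDr (le_trans (exprn_ile1 _ _ _))// lerDl exprn_ge0.
Qed.

(** The drop of the potential in one jump, times the exit rate, is the
    difference of two boundary terms.  Divided by [expR (- beta s)], this
    difference tends to 1 when first [e] tends to 0 and then [s] to 1. *)
Lemma potential_kernel i : (a < i)%N ->
  (\sum_(j <oo | (a < j)%N) (jump_matrix Q i j * potential j)%:E =
   (potential i - (s ^+ i * expR (- beta s) - e ^+ i * expR (- beta e)) / q i)%:E)%E.
Proof.
move=> ai; have i0 : (0 < i)%N by apply: leq_ltn_trans ai.
have Pi0 j : 0 <= jump_matrix Q i j by exact: jump_matrix_ge0.
transitivity (\sum_(j <oo | (a < j)%N) \int[leb]_(v in `[e, s])
    (jump_matrix Q i j * ((v ^+ a - v ^+ j) * W v))%:E)%E.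
  apply: eq_eseriesr => j aj; rewrite EFinM potentialE//.
  by rewrite -integralZl//; exact: integrable_potential.
rewrite eseries_mkcond.
transitivity (\sum_(j <oo) \int[leb]_(v in `[e, s])
    (if (a < j)%N then (jump_matrix Q i j * ((v ^+ a - v ^+ j) * W v))%:E else 0))%E.
  apply: eq_eseriesr => j _; case: ifPn => // _; by rewrite integral0.
rewrite -integral_nneseries//; last 2 first.
- move=> j; have [aj|ja] := ltnP a j; last exact: measurable_cst.
  apply/measurable_EFinP; apply: measurable_funM => //.
  by apply/measurable_EFinP; exact: measurable_int (integrable_potential j).
- move=> j v /=; rewrite in_itv/= => /es01 v01; case: ifPn => // aj.
  by rewrite lee_fin mulr_ge0// diff_ge0// ltnW.
transitivity (\int[leb]_(v in `[e, s]) ((v ^+ a - v ^+ i) * W v -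
   (q i)^-1 * ((i%:R * v ^+ i.-1 * A v - v ^+ i * B v) * W v))%:E)%E.
  apply: eq_integral => v; rewrite inE/= in_itv/= => /es01 v01.
  rewrite -eseries_mkcond.
  transitivity ((W v)%:E * (\sum_(j <oo | (a < j)%N)
      (jump_matrix Q i j * (v ^+ a - v ^+ j))%:E))%E.
    rewrite -nneseriesZl.
      by apply: eq_eseriesr => j aj; rewrite -EFinM; congr EFin; ring.
    move=> j aj; rewrite lee_fin mulr_ge0// subr_ge0.
    by case/andP: v01 => /ltW v0 /ltW v1; rewrite ler_wiXn2l// ltnW.
  rewrite jump_power_diff//; last by case/andP: v01 => -> /ltW.
  by rewrite -EFinM; congr EFin; ring.
have iD : leb.-integrable `[e, s] (EFin \o (fun v =>
    (i%:R * v ^+ i.-1 * A v - v ^+ i * B v) * W v)).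
  by apply: integrable_segment => v /es01 v01; exact: cdrift.
have iqD : leb.-integrable `[e, s] (EFin \o (fun v => (q i)^-1 *
    ((i%:R * v ^+ i.-1 * A v - v ^+ i * B v) * W v))).
  apply: integrable_segment => v /es01 v01.
  by apply: continuousM; [exact: cst_continuous|exact: cdrift].
under eq_integral do rewrite EFinB.
rewrite (integralB_EFin _ (integrable_potential i) iqD)//.
rewrite -potentialE// EFinB; congr (_ - _)%E.
under eq_integral do rewrite EFinM.
by rewrite integralZl// integral_drift// -EFinM mulrC.
Qed.

End Fes.

End Potential.

(** * Comparison for the chain and positivity of the drift *)

Section GreenBounds.
Variables (R : realType) (Q : nat -> nat -> R).
Context d (T : measurableType d).
Variables (P : nat -> probability T R) (X : R -> T -> option nat).
Hypothesis HX : minimal_markov_chain Q P X.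
Hypothesis Q_ge0 : forall i j, 0 <= jump_matrix Q i j.
Hypothesis Hext : forall y,
  P y [set w | (first_passage_below 0 (X ^~ w) < +oo)%E] = 1%E.
Variables (a x : nat).
Hypothesis ax : (a < x)%N.

Let u n i := P x (visit X a n i).

Let u_fin n i : u n i \is a fin_num.
Proof. by apply: fin_num_measure; exact: measurable_visit HX _ _ _. Qed.

Local Open Scope ereal_scope.

Lemma green_le (F G : nat -> R) :
  (forall i, (0 <= F i)%R) -> (forall i, (0 <= G i)%R) ->
  (forall i, (a < i)%N ->
     \sum_(j <oo | (a < j)%N) (jump_matrix Q i j * F j)%:E + (G i)%:E <=
     (F i)%:E) ->
  \sum_(n <oo) \sum_(i <oo) P x (visit X a n i) * (G i)%:E <= (F x)%:E.
Proof.
move=> F0 G0 FG; apply: (superharmonic_le Q_ge0 _ u_fin _ _ _ F0 G0 FG) => //.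
- by move=> i; exact: (visit0 HX).
- by move=> n i ia; exact: visit_below.
- by move=> n j aj; exact: (visitS HX).
Qed.

Lemma green_ge (F G : nat -> R) (C : R) :
  (forall i, (0 <= F i <= C)%R) -> (forall i, (0 <= G i)%R) ->
  (forall i, (a < i)%N ->
     (F i)%:E <=
     \sum_(j <oo | (a < j)%N) (jump_matrix Q i j * F j)%:E + (G i)%:E) ->
  (F x)%:E <= \sum_(n <oo) \sum_(i <oo) P x (visit X a n i) * (G i)%:E.
Proof.
move=> F0 G0 FG; apply: (subharmonic_le Q_ge0 _ u_fin _ _ _ _ F0 G0 FG) => //.
- by move=> i; exact: (visit0 HX).
- by move=> n i ia; exact: visit_below.
- by move=> n j aj; exact: (visitS HX).
- have := stays_above_cvg0 HX a (Hext x).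
  by under eq_fun do rewrite (sum_visit HX).
Qed.

End GreenBounds.

Section Extinction.
Variables (R : realType) (lam mu : R) (p : nat -> R) (r : int -> R).
Context d (T : measurableType d).
Variables (P : nat -> probability T R) (X : R -> T -> option nat).
Hypothesis Hpar : admissible lam mu p r.
Hypothesis HX : minimal_markov_chain (generator lam mu p r) P X.
Hypothesis Hext : forall y,
  P y [set w | (first_passage_below 0 (X ^~ w) < +oo)%E] = 1%E.

(** Otherwise there is [m < 1] at which [drift_p] is negative, and then the
    generator maps [m ^+ n] to a nonpositive function for all large [n].  So
    [m ^+ N - m ^+ j] is bounded and subharmonic for the chain killed at [N],
    which almost sure extinction forbids, as this function is positive at
    [N.+1]. *)
Lemma drift_p_gt0 v : 0 < v < 1 -> 0 < drift_p lam p v.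
Proof.
move=> /andP[v0 v1]; have lam0 := lam_gt0 Hpar.
rewrite /drift_p pmulr_rgt0// subr_gt0 ltNge; apply/negP => pv.
have [m m01 pm] := pgf_lt_fix (p_distribution Hpar) (p1_eq0 Hpar)
  (ltac:(by rewrite ltW) : 0 <= v < 1) pv.
have /andP[m0 m1] := m01.
have Am : drift_p lam p m < 0 by rewrite /drift_p pmulr_rlt0// subr_lt0.
pose c := m * drift_r mu r m / drift_p lam p m.
pose N := Num.bound `|c|.
have HN i : (N < i)%N ->
    i%:R * drift_p lam p m - m * drift_r mu r m <= 0.
  move=> Ni; rewrite subr_le0 -ler_ndivrMr//.
  rewrite (le_trans (ler_norm c))// (le_trans (ltW (archi_boundP (normr_ge0 c))))//.
  by rewrite ler_nat ltnW.
pose F j := if (N < j)%N then m ^+ N - m ^+ j else 0.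
have F01 j : 0 <= F j <= 1.
  rewrite /F; case: ifPn => [Nj|_]; last by rewrite lexx ler01.
  rewrite subr_ge0 ler_wiXn2l ?(ltW m0) ?(ltW m1) ?(ltnW Nj)//=.
  rewrite lerBlDr (le_trans (exprn_ile1 _ _ _)) ?(ltW m0) ?(ltW m1)//.
  by rewrite lerDl exprn_ge0// ltW.
have FK i : (N < i)%N -> ((F i)%:E <= \sum_(j <oo | (N < j)%N)
    (jump_matrix (generator lam mu p r) i j * F j)%:E + (0 : R)%:E)%E.
  move=> Ni; have i0 : (0 < i)%N by apply: leq_ltn_trans Ni.
  rewrite adde0 (_ : (\sum_(j <oo | _) _)%E = (\sum_(j <oo | (N < j)%N)
    (jump_matrix (generator lam mu p r) i j * (m ^+ N - m ^+ j))%:E)%E); last first.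
    by apply: eq_eseriesr => j Nj; rewrite /F Nj.
  rewrite (jump_power_diff Hpar)// ?m0 ?(ltW m1)// lee_fin /F Ni lerDl oppr_ge0.
  rewrite ler_pdivrMr ?mul0r; last exact: (exit_rate_gt0 Hpar).
  rewrite -(prednK i0) exprS /= (prednK i0).
  have := HN i Ni; have : 0 <= m ^+ i.-1 by rewrite exprn_ge0// ltW.
  move: (m ^+ i.-1) (drift_p lam p m) (drift_r mu r m) => y D B y0 H.
  have -> : i%:R * y * D - m * y * B = y * (i%:R * D - m * B) by ring.
  exact: mulr_ge0_le0.
have := green_ge HX (jump_matrix_ge0 Hpar) Hext (ltnSn N) F01 (fun=> lexx _) FK.
rewrite eseries0; last first.
  by move=> n _ _; rewrite eseries0// => i _ _; rewrite mule0.
by rewrite lee_fin /F ltnSn leNgt subr_gt0 exprS gtr_pMl ?exprn_gt0// m1.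
Qed.

End Extinction.

(** * Behaviour of the exponential weight at the endpoints *)

Lemma cvg_expeR (R : realType) (u : nat -> R) (L : \bar R) : (-oo < L)%E ->
  (u n)%:E @[n --> \oo] --> L -> (expR (u n))%:E @[n --> \oo] --> expeR L.
Proof.
case: L => [l| |//] _ ul.
  apply/fine_cvgP; split; first exact: nearW.
  have /fine_cvgP[_ ul'] := ul.
  have H : expR (u n) @[n --> \oo] --> expR l.
    by apply: continuous_cvg; [exact: continuous_expR|exact: ul'].
  exact: H.
apply/cvgeryP; move/cvgeryP : ul => /cvgryPge ul.
apply/cvgryPge => M; near=> n.
apply: (@le_trans _ _ (u n)); first by near: n; exact: ul.
by apply: le_trans (expR_ge1Dx _); rewrite lerDr.
Unshelve. all: by end_near. Qed.

(** Upper endpoints increasing to 1 and lying above [phi], where [beta] is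
    nondecreasing. *)
Definition cut (R : realType) (phi : R) (n : nat) : R :=
  1 - (1 - phi) / n.+2%:R.

Section Weight.
Variables (R : realType) (lam mu : R) (p : nat -> R) (r : int -> R) (phi : R).
Hypothesis Hpar : admissible lam mu p r.
Hypothesis Hphi : is_phi mu r phi.
Hypothesis phi1 : phi < 1.
Notation leb := (@lebesgue_measure R).

Let A := drift_p lam p.
Let B := drift_r mu r.

Hypothesis A_gt0 : forall v : R, 0 < v < 1 -> 0 < A v.
Variable beta : R -> R.
Hypothesis dbeta : forall v : R, 0 < v < 1 -> is_derive v 1 beta (B v / A v).

Let b v := B v / A v.

Let cb (v : R) : 0 < v < 1 -> {for v, continuous b}.
Proof.
move=> v01; apply: continuousM; first exact: (continuous_drift_r Hpar).
apply: continuousV; first by rewrite gt_eqF// A_gt0.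
exact: (continuous_drift_p Hpar).
Qed.

Let b_ge0 (v : R) : 0 < v < 1 -> phi <= v -> 0 <= b v.
Proof.
move=> v01 phiv; have /andP[v0 v1] := v01.
by rewrite divr_ge0 ?(ltW (A_gt0 v01))// (drift_r_ge0 Hpar Hphi)// ltW.
Qed.

Lemma beta_nd (v w : R) : 0 < v -> phi <= v -> v <= w -> w < 1 -> beta v <= beta w.
Proof.
move=> v0 phiv vw w1; apply: (@derive_le_homo _ beta b) => // t /andP[vt tw].
  by apply: dbeta; rewrite (lt_le_trans v0)//= (le_lt_trans tw).
by apply: b_ge0; rewrite ?(lt_le_trans v0)//= ?(le_lt_trans tw)// (le_trans phiv).
Qed.

(** A convex function that is positive before its zero at 1 is nonincreasing
    there. *)
Lemma le_drift_p_half v : 0 < v <= 1 / 2 -> A (1 / 2) <= A v.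
Proof.
move=> /andP[v0 vh]; rewrite /A /drift_p ler_pM2l ?(lam_gt0 Hpar)//.
have h1 : 1 / 2 <= 1 :> R by lra.
have := pgf_chord (p_distribution Hpar) (ltW v0) vh h1.
have : 0 < A (1 / 2) by apply: A_gt0; apply/andP; split; lra.
rewrite /A /drift_p pmulr_rgt0 ?(lam_gt0 Hpar)// subr_gt0.
move: (pgf_p p (1 / 2)) (pgf_p p v) => y z hy hz.
have : 0 <= (1 / 2 - v) * (y - 1 / 2) by rewrite mulr_ge0// subr_ge0// ltW.
by move: hz; nra.
Qed.

(** The only singularity of [drift_r / drift_p] at 0 is the term in [- 1 / v],
    which has the favourable sign: the quotient is bounded above there, hence
    [- beta] is bounded above near 0. *)
Lemma weight_bounded : exists2 M : R, 0 < M &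
  forall v : R, 0 < v <= 1 / 2 -> expR (- beta v) <= M.
Proof.
have h01 : 0 < (1 / 2 : R) < 1 by apply/andP; split; lra.
have Ah := A_gt0 h01.
pose K := mu / A (1 / 2).
exists (expR (K / 2 - beta (1 / 2))); first exact: expR_gt0.
move=> v /andP[v0 vh]; rewrite ler_expR.
have : K * v - beta v <= K * (1 / 2) - beta (1 / 2).
  apply: (@derive_le_homo _ (fun t => K * t - beta t) (fun t => K - b t)) => //.
    move=> t /andP[vt th]; apply: is_deriveB; last first.
      by apply: dbeta; rewrite (lt_le_trans v0)//= (le_lt_trans th)//; lra.
    by apply: is_derive_eq; rewrite [LHS]mulr1.
  move=> t /andP[vt th]; have t0 := lt_le_trans v0 vt.
  have t01 : 0 < t < 1 by rewrite t0/= (le_lt_trans th)//; lra.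
  rewrite subr_ge0; apply: (@le_trans _ _ (mu / A t)).
    rewrite ler_wpM2r ?invr_ge0 ?(ltW (A_gt0 t01))//.
    by apply: (drift_r_le Hpar); case/andP: t01 => -> /ltW.
  rewrite ler_wpM2l ?(mu_ge0 Hpar)// lef_pV2 ?posrE ?A_gt0//.
  by rewrite le_drift_p_half// t0.
have : 0 <= K * v by rewrite mulr_ge0 ?(ltW v0)// divr_ge0 ?(mu_ge0 Hpar)// ltW.
by lra.
Qed.

(** Provides a lower endpoint whose boundary term is negligible against that of
    the upper endpoint [t]. *)
Lemma weight_small (t : R) : 0 < t < 1 -> exists2 e : R, 0 < e <= t &
  e * expR (- beta e) <= t * (1 - t) * expR (- beta t).
Proof.
move=> /andP[t0 t1]; have [M M0 HM] := weight_bounded.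
have c0 : 0 < t * (1 - t) * expR (- beta t) by rewrite !mulr_gt0 ?expR_gt0// subr_gt0.
pose e := Num.min (Num.min t (1 / 2)) (t * (1 - t) * expR (- beta t) / M).
have e0 : 0 < e by rewrite !lt_min t0 !divr_gt0.
have [et eh eM] : [/\ e <= t, e <= 1 / 2 & e <= t * (1 - t) * expR (- beta t) / M].
  by rewrite !ge_min !lexx !orbT.
exists e; first by rewrite e0.
apply: (@le_trans _ _ (e * M)); last by rewrite -ler_pdivlMr.
by rewrite ler_pM2l// HM// e0.
Qed.

Let s n := cut phi n.

Let phi_ge0 : 0 <= phi.
Proof. by move: Hphi; rewrite /is_phi; case: ifPn => [_ [/andP[/ltW]]|_ ->]. Qed.

Lemma cut_ge n : phi <= cut phi n.
Proof.
rewrite /cut lerBrDr -lerBrDl ler_piMr ?subr_ge0 ?(ltW phi1)//.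
by rewrite invf_le1 ?ler1n ?ltr0n.
Qed.

Lemma cut_half n : 1 / 2 <= cut phi n.
Proof.
rewrite /cut lerBrDr -lerBrDl.
rewrite ler_pdivrMr ?ltr0n//.
have : 2 <= n.+2%:R :> R by rewrite ler_nat.
have := phi_ge0; have := phi1; move: (n.+2%:R) => y; nra.
Qed.

Lemma cut_gt0 n : 0 < cut phi n.
Proof. by apply: lt_le_trans (cut_half n). Qed.

Lemma cut_lt1 n : cut phi n < 1.
Proof. by rewrite /cut gtrBl divr_gt0 ?subr_gt0. Qed.

Lemma cut_nd m n : (m <= n)%N ->
  cut phi m <= cut phi n.
Proof.
move=> mn; rewrite /cut lerD2l lerN2 ler_pM2l ?subr_gt0//.
by rewrite lef_pV2 ?posrE ?ltr0n// ler_nat.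
Qed.

Lemma cut_cvg : cut phi n @[n --> \oo] --> (1 : R).
Proof.
rewrite /cut -[X in _ --> X]subr0; apply: cvgB; first exact: cvg_cst.
rewrite -(mulr0 (1 - phi)); apply: cvgMr.
have E := @cvg_shiftS R^o (@harmonic R) (nbhs (0 : R)).
have h := @cvg_harmonic R.
by rewrite -E in h.
Qed.

Lemma cut_near v : v < 1 -> \forall n \near \oo, v <= cut phi n.
Proof.
move=> v1; have := cut_cvg => /cvgrPdist_le /(_ (1 - v)).
rewrite subr_gt0 => /(_ v1); apply: filterS => n.
by rewrite ger0_norm ?subr_ge0 ?(ltW (cut_lt1 n))// lerD2l lerN2.
Qed.

(** The limit may be infinite.  The negative part of the integrand vanishes
    above [phi] and has a finite integral, and the integrals of the positive part
    increase to their limit. *)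
Lemma exponent_cvg (v : R) : 0 < v < 1 ->
  (beta (cut phi n) - beta v)%:E @[n --> \oo] -->
  (\int[leb]_(w in `]v, 1%R[) (B w / A w)%:E)%E.
Proof.
move=> /andP[v0 v1].
pose f w : \bar R := (b w)%:E.
pose S n : set R := `]v, s n]%classic.
have mS n : measurable (S n) by exact: measurable_itv.
have Suni : \bigcup_n S n = `]v, 1[%classic.
  apply/seteqP; split => w /=.
    move=> [n _]; rewrite /S/= !in_itv/= => /andP[-> ws].
    exact: le_lt_trans ws (cut_lt1 n).
  rewrite in_itv/= => /andP[vw w1].
  have [n _ /(_ n (leqnn n)) ws] := cut_near w1.
  by exists n => //; rewrite /S/= in_itv/= vw.
have iS n : leb.-integrable (S n) f.
  apply: (@integrableS _ _ _ leb `[v, s n]%classic) => //.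
    exact: measurable_itv.
    by move=> w; rewrite /S/= !in_itv/= => /andP[/ltW -> ->].
  apply: integrable_segment => w /andP[vw ws]; apply: cb.
  by rewrite (lt_le_trans v0)//= (le_lt_trans ws)// cut_lt1.
have mf : measurable_fun `]v, 1[%classic f.
  rewrite -Suni; apply/measurable_fun_bigcup => n; first exact: mS.
  exact: measurable_int (iS n).
have c1 : (\int[leb]_(w in S n) f^\+ w)%E @[n --> \oo] -->
          (\int[leb]_(w in `]v, 1%R[) f^\+ w)%E.
  rewrite -Suni; apply: ge0_nondecreasing_set_cvg_integral => //.
  - move=> m n mn; apply/subsetPset => w; rewrite /S/= !in_itv/= => /andP[-> ws].
    exact: le_trans ws (cut_nd mn).
  - by move=> n; apply: measurable_funepos; exact: measurable_int (iS n).
have c2 n : (\int[leb]_(w in S n) f^\- w = \int[leb]_(w in `]v, 1%R[) f^\- w)%E.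
  rewrite integral_mkcond [RHS]integral_mkcond; apply: eq_integral => w _.
  rewrite !patchE; case: ifPn => [|wS].
    rewrite /S inE/= in_itv/= => /andP[vw ws].
    by rewrite mem_set//= in_itv/= vw (le_lt_trans ws)// cut_lt1.
  case: ifPn => //; rewrite inE/= in_itv/= => /andP[vw w1].
  move: wS; rewrite notin_setE /S/= in_itv/= vw/= => /negP; rewrite -ltNge => sw.
  rewrite funenegE /f; apply/esym/max_idPr.
  rewrite leeNl oppe0 lee_fin b_ge0 ?(lt_trans v0 vw)//=.
  exact: le_trans (cut_ge n) (ltW sw).
have fin : (\int[leb]_(w in `]v, 1%R[) f^\- w \is a fin_num)%E.
  rewrite -(c2 0%N); apply: (integrable_neg_fin_num _ (iS 0%N)); exact: measurable_itv.
rewrite [X in _ --> X]integralE.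
have : (\int[leb]_(w in S n) f^\+ w - \int[leb]_(w in `]v, 1%R[) f^\- w)%E
    @[n --> \oo] --> (\int[leb]_(w in `]v, 1%R[) f^\+ w -
                      \int[leb]_(w in `]v, 1%R[) f^\- w)%E.
  apply: cvgeB => //; last exact: cvg_cst.
  by rewrite fin_num_adde_defl// fin_numN.
apply: cvg_trans; apply: near_eq_cvg.
apply: filterS (cut_near v1) => n vs.
rewrite -(c2 n) -integralE.
have -> : (\int[leb]_(w in S n) f w = \int[leb]_(w in `[v, s n]) f w)%E.
  rewrite /S integral_itv_obnd_cbnd//.
  exact: measurable_int (iS n).
apply: FTC2_segment => // w /andP[vw ws].
  by apply: cb; rewrite (lt_le_trans v0)//= (le_lt_trans ws)// cut_lt1.
by apply: dbeta; rewrite (lt_le_trans v0)//= (le_lt_trans ws)// cut_lt1.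
Qed.

End Weight.

(** * The integral formula *)

Section Formula.
Variables (R : realType) (lam mu : R) (p : nat -> R) (r : int -> R).
Context d (T : measurableType d).
Variables (P : nat -> probability T R) (X : R -> T -> option nat) (phi : R).
Variables (x a : nat).
Hypothesis Hpar : admissible lam mu p r.
Hypothesis HX : minimal_markov_chain (generator lam mu p r) P X.
Hypothesis Hext : forall y,
  P y [set w | (first_passage_below 0 (X ^~ w) < +oo)%E] = 1%E.
Hypothesis Hphi : is_phi mu r phi.
Hypothesis phi1 : phi < 1.
Hypothesis ax : (a < x)%N.
Variable beta : R -> R.
Hypothesis dbeta : forall v : R, 0 < v < 1 ->
  is_derive v 1 beta (drift_r mu r v / drift_p lam p v).

Notation leb := (@lebesgue_measure R).
Let A_gt0 (v : R) := drift_p_gt0 Hpar HX Hext (v := v).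
Let q := exit_rate (generator lam mu p r).
Let W := weight lam p beta.

Let q_ge0 i : 0 <= (q i)^-1.
Proof.
rewrite invr_ge0; case: i => [|i]; last exact/ltW/(exit_rate_gt0 Hpar).
by rewrite /q /exit_rate /generator/= oppr0.
Qed.

Let green (G : nat -> R) :=
  (\sum_(n <oo) \sum_(i <oo) P x (visit X a n i) * (G i)%:E)%E.

Let greenZ c G : (forall i, 0 <= G i) ->
  green (fun i => c * G i) = (c%:E * green G)%E.
Proof.
move=> G0.
have gG n i : (0 <= P x (visit X a n i) * (G i)%:E)%E by rewrite mule_ge0 ?lee_fin.
rewrite /green -nneseriesZl; last by move=> n _; exact: nneseries_ge0.
apply: eq_eseriesr => n _; rewrite -nneseriesZl//.
by apply: eq_eseriesr => i _; rewrite EFinM muleCA.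
Qed.

(** Dropping the boundary term at [e] overestimates the one-step drop of the
    potential. *)
Lemma potential_le_green (e s : R) : 0 < e -> e <= s -> s < 1 ->
  ((expR (beta s) * potential lam p beta a e s x)%:E <=
   green (fun i => (q i)^-1)%R)%E.
Proof.
move=> e0 es s1.
have F0C i : 0 <= potential lam p beta a e s i <=
    \int[leb]_(v in `[e, s]) W v.
  by rewrite (potential_ge0 A_gt0)//= (potential_le Hpar A_gt0 dbeta).
pose G i := expR (- beta s) * (q i)^-1.
have G0 i : 0 <= G i by rewrite mulr_ge0// expR_ge0.
have FG i : (a < i)%N -> ((potential lam p beta a e s i)%:E <=
  \sum_(j <oo | (a < j)%N) (jump_matrix (generator lam mu p r) i j *
      potential lam p beta a e s j)%:E + (G i)%:E)%E.
  move=> ai; rewrite (potential_kernel Hpar A_gt0 dbeta)// -EFinD lee_fin.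
  rewrite -addrA lerDl addrC subr_ge0 /G ler_wpM2r//.
  rewrite lerBlDr (@le_trans _ _ (expR (- beta s)))//.
    rewrite ler_piMl ?expR_ge0// exprn_ile1// ltW//.
    exact: lt_le_trans es.
  by rewrite lerDl mulr_ge0 ?expR_ge0// exprn_ge0// ltW.
have := green_ge HX (jump_matrix_ge0 Hpar) Hext ax F0C G0 FG.
have b0 : (0 <= (expR (beta s))%:E)%E by rewrite lee_fin expR_ge0.
rewrite -/(green G) greenZ// => /(lee_wpmul2l b0).
by rewrite muleA -!EFinM -expRD subrr expR0 mul1e.
Qed.

(** For a suitable [e] the boundary term at [e] costs at most the factor [t] in
    the one-step drop of the potential. *)
Lemma green_le_potential (t : R) : 0 < t < 1 -> exists2 e : R, 0 < e <= t &
  (green (fun i => t ^+ i.+1 / q i)%R <=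
   (expR (beta t) * potential lam p beta a e t x)%:E)%E.
Proof.
move=> t01; have /andP[t0 t1] := t01.
have [e /andP[e0 et] He] := weight_small Hpar A_gt0 dbeta t01.
exists e; first by rewrite e0.
pose G i := expR (- beta t) * (t ^+ i.+1 / q i).
have H0 i : 0 <= t ^+ i.+1 / q i by rewrite mulr_ge0// exprn_ge0// ltW.
have G0 i : 0 <= G i by rewrite mulr_ge0// expR_ge0.
have FG i : (a < i)%N -> (
  \sum_(j <oo | (a < j)%N) (jump_matrix (generator lam mu p r) i j *
      potential lam p beta a e t j)%:E + (G i)%:E <=
  (potential lam p beta a e t i)%:E)%E.
  move=> ai; rewrite (potential_kernel Hpar A_gt0 dbeta)// -EFinD lee_fin.
  rewrite -addrA gerDl addrC subr_le0 /G mulrA ler_wpM2r//.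
  case: i ai => [//|i] _.
  have ei : e ^+ i <= t ^+ i by rewrite lerXn2r// nnegrE ltW.
  have := ler_pM (exprn_ge0 i (ltW e0)) (mulr_ge0 (ltW e0) (expR_ge0 (- beta e))) ei He.
  rewrite !exprS; move: (expR (- beta e)) (expR (- beta t)) (e ^+ i) (t ^+ i).
  move=> ge gt ei' ti; nra.
have := green_le HX (jump_matrix_ge0 Hpar) ax
  (potential_ge0 A_gt0 beta a e0 t1) G0 FG.
have b0 : (0 <= (expR (beta t))%:E)%E by rewrite lee_fin expR_ge0.
rewrite -/(green G) greenZ// => /(lee_wpmul2l b0).
by rewrite muleA -!EFinM -expRD subrr expR0 mul1e.
Qed.

(** The integrand of the formula, and its approximations with upper endpoint
    [cut phi n] in the exponent. *)
Let h (v : R) : \bar R := ((v ^+ a - v ^+ x)%:E *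
  (expeR (\int[leb]_(w in `]v, 1%R[) (drift_r mu r w / drift_p lam p w)%:E) *
   ((drift_p lam p v)^-1)%:E))%E.

Let g n (v : R) : \bar R :=
  (((v ^+ a - v ^+ x) * (expR (beta (cut phi n)) * W v))%:E)%E.

Let g_ge0 n (v : R) : 0 < v < 1 -> (0 <= g n v)%E.
Proof.
move=> v01; rewrite lee_fin mulr_ge0//; last first.
  by rewrite mulr_ge0 ?expR_ge0 ?(ltW (weight_gt0 A_gt0 _ v01)).
case/andP: v01 => /ltW v0 /ltW v1.
by rewrite subr_ge0 ler_wiXn2l// ltnW.
Qed.

Let cut_beta m n : (m <= n)%N -> beta (cut phi m) <= beta (cut phi n).
Proof.
move=> mn; apply: (beta_nd Hpar Hphi phi1 A_gt0 dbeta).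
- exact: (cut_gt0 Hphi phi1).
- exact: cut_ge.
- exact: cut_nd.
- exact: cut_lt1.
Qed.

Let mg n : measurable_fun (`]0%R, 1%R[%classic : set R) (g n).
Proof.
apply/measurable_EFinP; apply: open_continuous_measurable_fun => //.
move=> v; rewrite inE/= in_itv/= => v01.
suff : {for v, continuous (fun y : R =>
  (y ^+ a - y ^+ x) * (expR (beta (cut phi n)) * W y))} by [].
apply: continuousM.
  by apply: continuousB; [exact: (@exprn_continuous _ a v)|exact: (@exprn_continuous _ x v)].
apply: continuousM; first exact: cst_continuous.
exact: (continuous_weight Hpar A_gt0 dbeta).
Qed.

Let g_nd m n (v : R) : 0 < v < 1 -> (m <= n)%N -> (g m v <= g n v)%E.
Proof.
move=> v01 mn; rewrite lee_fin ler_wpM2l//.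
  case/andP: v01 => /ltW v0 /ltW v1.
  by rewrite subr_ge0 ler_wiXn2l// ltnW.
by rewrite ler_wpM2r ?(ltW (weight_gt0 A_gt0 _ v01))// ler_expR cut_beta.
Qed.

Let g_cvg (v : R) : 0 < v < 1 -> g n v @[n --> \oo] --> h v.
Proof.
move=> v01; have A0 := A_gt0 v01.
rewrite (_ : (fun n => g n v) = fun n => ((v ^+ a - v ^+ x)%:E *
   ((expR (beta (cut phi n) - beta v))%:E * ((drift_p lam p v)^-1)%:E))%E); last first.
  apply/funext => n; rewrite /g /W /weight -!EFinM; congr EFin.
  by rewrite expRD !mulrA.
have Ec := exponent_cvg Hpar Hphi phi1 A_gt0 dbeta v01.
apply: cvgeZl => //; apply: cvgeZr => //; apply: cvg_expeR.
  apply: (@lt_le_trans _ _ (beta (cut phi 0) - beta v)%:E); first exact: ltNyr.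
  rewrite -(cvg_lim _ Ec)//; apply: lime_ge; first by apply/cvg_ex; eexists; exact: Ec.
  by apply: nearW => n; rewrite lee_fin lerD2r cut_beta.
exact: Ec.
Qed.

Let D (n : nat) : set R := `[n.+3%:R^-1, cut phi n]%classic.

Let integral_g e n : 0 < e -> e <= cut phi n ->
  (\int[leb]_(v in `[e, cut phi n]) g n v =
  (expR (beta (cut phi n)) * potential lam p beta a e (cut phi n) x)%:E)%E.
Proof.
move=> e0 es; have s1 := cut_lt1 phi1 n.
rewrite EFinM (potentialE Hpar A_gt0 dbeta)//.
rewrite -integralZl//; last exact: (integrable_potential Hpar A_gt0 dbeta).
by apply: eq_integral => v _; rewrite -EFinM /g mulrCA.
Qed.

Let cut_ge_inv n : n.+3%:R^-1 <= cut phi n.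
Proof.
apply: le_trans (cut_half Hphi phi1 n); rewrite -[1 / 2]invf_div divr1.
by rewrite lef_pV2 ?posrE// ler_nat.
Qed.

(** Monotone convergence along the compact intervals from 1 / (n + 3) to
    [cut phi n]. *)
Lemma formula_le_green :
  (\int[leb]_(v in `]0%R, 1%R[) h v <= green (fun i => (q i)^-1)%R)%E.
Proof.
pose k n := g n \_ (D n).
have mk n : measurable_fun (`]0%R, 1%R[%classic : set R) (k n).
  apply/measurable_restrict; [exact: measurable_itv|exact: measurable_itv|].
  by apply: measurable_funS (mg n); [exact: measurable_itv|exact: subIsetl].
have D01 n v : D n v -> 0 < v < 1.
  rewrite /D/= in_itv/= => /andP[h1 h2].
  by rewrite (lt_le_trans _ h1) ?invr_gt0// (le_lt_trans h2)// cut_lt1.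
have k0 n v : `]0%R, 1%R[%classic v -> (0 <= k n v)%E.
  by move=> _; apply: erestrict_ge0 => {}v /D01; exact: g_ge0.
have DS m n : (m <= n)%N -> D m `<=` D n.
  move=> mn v; rewrite /D/= !in_itv/= => /andP[h1 h2].
  rewrite (le_trans h2 (cut_nd phi1 mn)) andbT (le_trans _ h1)//.
  by rewrite lef_pV2 ?posrE// ler_nat !ltnS.
have ndk v : `]0%R, 1%R[%classic v -> {homo k^~ v : n m / (n <= m)%N >-> (n <= m)%E}.
  rewrite /= in_itv/= => v01 m n mn; rewrite /k !patchE.
  case: ifPn => [/set_mem vm|_]; first by rewrite mem_set ?g_nd//; exact: DS vm.
  by case: ifPn => // _; exact: g_ge0.
have kcvg v : 0 < v < 1 -> k n v @[n --> \oo] --> h v.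
  move=> v01; apply: cvg_trans (g_cvg v01); apply: near_eq_cvg.
  have /andP[v0 v1] := v01.
  near=> n; rewrite /k patchE mem_set//= /D/= in_itv/=; apply/andP; split.
    apply: (@le_trans _ _ n.+1%:R^-1); first by rewrite lef_pV2 ?posrE// ler_nat ltnS -addn2 leq_addr.
    by apply/ltW; near: n; exact: (near_infty_natSinv_lt (PosNum v0)).
  by near: n; exact: cut_near.
have cv := cvg_monotone_convergence (mu := leb) (measurable_itv `]0%R, 1%R[) mk k0 ndk.
rewrite (_ : (\int[leb]_(v in `]0%R, 1%R[) h v)%E =
   limn (fun n => \int[leb]_(v in `]0%R, 1%R[) k n v)%E); last first.
  rewrite (cvg_lim _ cv)//; apply: eq_integral => v.
  by rewrite inE/= in_itv/= => v01; apply/esym/cvg_lim => //; exact: kcvg.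
apply: lime_le; first by apply/cvg_ex; eexists; exact: cv.
apply: nearW => n; rewrite -integral_mkcondr.
rewrite (_ : _ `&` _ = D n); last first.
  by apply/setIidPr => v /D01 v01; rewrite /= in_itv.
rewrite integral_g ?invr_gt0//.
by apply: potential_le_green; rewrite ?invr_gt0//; exact: cut_lt1.
Unshelve. all: by end_near. Qed.

Let mh : measurable_fun (`]0%R, 1%R[%classic : set R) h.
Proof.
apply: (emeasurable_fun_cvg g) => // v; rewrite /= in_itv/=; exact: g_cvg.
Qed.

Let g_le_h n v : 0 < v < 1 -> (g n v <= h v)%E.
Proof.
move=> v01; have gh := g_cvg v01.
rewrite -(cvg_lim _ gh)//; apply: lime_ge; first by apply/cvg_ex; eexists; exact: gh.
by near=> m; apply: g_nd => //; near: m; exact: nbhs_infty_ge.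
Unshelve. all: by end_near. Qed.

Let green_cut_le n : (green (fun i => cut phi n ^+ i.+1 / q i)%R <=
  \int[leb]_(v in `]0%R, 1%R[) h v)%E.
Proof.
have s01 : 0 < cut phi n < 1 by rewrite cut_lt1// (cut_gt0 Hphi).
have [e /andP[e0 es]] := green_le_potential s01.
move=> /le_trans; apply; rewrite -integral_g//.
have sub : `[e, cut phi n]%classic `<=` `]0%R, 1%R[%classic.
  move=> v; rewrite /= !in_itv/= => /andP[ev vs].
  by rewrite (lt_le_trans e0)//= (le_lt_trans vs)// cut_lt1.
have in01 v : `]0%R, 1%R[%classic v -> 0 < v < 1 by rewrite /= in_itv.
apply: (@le_trans _ _ (\int[leb]_(v in `]0%R, 1%R[) g n v)%E).
  apply: ge0_subset_integral => //; first exact: mg.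
  by move=> v /in01 v01; exact: g_ge0.
apply: ge0_le_integral => //.
- by move=> v /in01 v01; exact: g_ge0.
- exact: mg.
- by move=> v /in01 v01; exact: g_le_h.
Qed.

(** The weights [cut phi n ^+ i.+1] are removed on finitely many states at a
    time. *)
Lemma green_le_formula :
  (green (fun i => (q i)^-1)%R <= \int[leb]_(v in `]0%R, 1%R[) h v)%E.
Proof.
pose gr i := (\sum_(n <oo) P x (visit X a n i))%E.
have gr0 i : (0 <= gr i)%E by exact: nneseries_ge0.
have greenE G : (forall i, 0 <= G i) ->
    green G = (\sum_(i <oo) gr i * (G i)%:E)%E.
  move=> G0; rewrite /green nneseries_interchange; last first.
    by move=> n i; rewrite mule_ge0// lee_fin.
  apply: eq_eseriesr => i _; rewrite muleC -nneseriesZl//.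
  by apply: eq_eseriesr => n _; rewrite muleC.
have cq0 n i : 0 <= cut phi n ^+ i.+1 / q i.
  by rewrite mulr_ge0// exprn_ge0// ltW// (cut_gt0 Hphi).
rewrite greenE//; apply: lime_le.
  by apply: is_cvg_nneseries => i _ _; rewrite mule_ge0// lee_fin.
apply: nearW => I; apply/lee_mul01Pr.
  by apply: sume_ge0 => i _; rewrite mule_ge0// lee_fin.
move=> th /andP[th0 th1].
have [n thn] : exists n, th <= cut phi n ^+ I.
  have cI : cut phi n ^+ I @[n --> \oo] --> (1 : R).
    have e1 := @exprn_continuous R I 1; rewrite /continuous_at expr1n in e1.
    by apply: cvg_comp e1; exact: cut_cvg.
  have := cI => /cvgrPdist_le /(_ (1 - th)); rewrite subr_gt0 => /(_ th1).
  move=> [n _ /(_ n (leqnn n))/= H]; exists n.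
  by have := le_trans (ler_norm _) H; rewrite lerD2l lerN2.
apply: le_trans (green_cut_le n); rewrite greenE//.
apply: (@le_trans _ _ (\sum_(0 <= i < I) gr i * (cut phi n ^+ i.+1 / q i)%:E)%E).
  rewrite ge0_sume_distrr; last by move=> i _; rewrite mule_ge0// lee_fin.
  rewrite big_nat [leRHS]big_nat; apply: lee_sum => i /andP[_ iI].
  rewrite muleCA lee_wpmul2l// -EFinM lee_fin ler_wpM2r//.
  apply: (le_trans thn); apply: ler_wiXn2l => //; first by rewrite ltW// (cut_gt0 Hphi).
  by rewrite ltW// cut_lt1.
by apply: nneseries_lim_ge => i _; rewrite mule_ge0// lee_fin.
Qed.

End Formula.

Theorem corollary5p2 (R : realType) (lam mu : R) (p : nat -> R) (r : int -> R)
  (d : measure_display) (T : measurableType d) (P : nat -> probability T R)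
  (X : R -> T -> option nat) (phi : R) (x a : nat)
  (Hpar : admissible lam mu p r)
  (HX : minimal_markov_chain (generator lam mu p r) P X)
  (Hext : forall y : nat,
     P y [set w | (first_passage_below 0 (X ^~ w) < +oo)%E] = 1%E)
  (Hphi : is_phi mu r phi) (Hphi1 : phi < 1) (Hax : (a < x)%N) :
  (\int[P x]_w first_passage_below a (X ^~ w) =
   \int[@lebesgue_measure R]_(v in `]0%R, 1%R[)
     ((v ^+ a - v ^+ x)%:E *
      (expeR (\int[@lebesgue_measure R]_(w in `]v, 1%R[)
                (mu * (1 - pgf_r r w) / (lam * (pgf_p p w - w)))%:E) *
       ((lam * (pgf_p p v - v))^-1)%:E)))%E.
Proof.
have A_gt0 (v : R) := drift_p_gt0 Hpar HX Hext (v := v).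
have [|beta dbeta] := @antiderivative_oo R (fun v => drift_r mu r v / drift_p lam p v).
  move=> v v01; apply: continuousM; first exact: (continuous_drift_r Hpar).
  apply: continuousV; first by rewrite gt_eqF// A_gt0.
  exact: (continuous_drift_p Hpar).
rewrite (mean_first_passage HX (Hext x)); last first.
  by move=> i ai; apply: (exit_rate_gt0 Hpar); exact: leq_ltn_trans ai.
apply/eqP; rewrite eq_le; apply/andP; split.
  exact: (green_le_formula Hpar HX Hext Hphi Hphi1 Hax dbeta).
exact: (formula_le_green Hpar HX Hext Hphi Hphi1 Hax dbeta).
Qed.
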